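(* Assume (H.1)–(H.5) (listed in the context), with $\kappa$ the constant of (H.5). Then for every function $f\in F_\kappa$, $$\lim_{n\to\infty}\frac1{m^n}\sum_{k\in\mathbb{G}_n^*}f(X_k^*,X_{2k}^*,X_{2k+1}^* )=\langle\mu,Pf\rangle\,W\quad\text{a.s.}$$
   Context: Tree. The positive integers form a binary tree, the offspring of $k$ being $2k$ and $2k+1$. $\mathbb{G}_n=\{2^n,\dots,2^{n+1}-1\}$. R-BAR process. $(a,b,c,d)\in\mathbb{R}^4$, $X_1$ is a real random variable and for all $k\ge1$ $$X_{2k}=(b+\eta_{2k})X_k+a+\varepsilon_{2k},\qquad X_{2k+1}=(d+\eta_{2k+1})X_k+c+\varepsilon_{2k+1}.$$ Put $a_2=a,\ b_2=b,\ a_3=c,\ b_3=d$. Observation process. $\delta_1=1$, $\delta_{2k}=\delta_k\xi_k^0$, $\delta_{2k+1}=\delta_k\xi_k^1$, where $(\xi_k^0,\xi_k^1)_{k\ge1}$ are i.i.d. in $\{0,1\}^2$ taking the values $(1,0),(0,1),(1,1),(0,0)$ with probabilities $p_0,p_1,p_{01},1-p_0-p_1-p_{01}$. $\mathbb{G}_n^*=\{k\in\mathbb{G}_n:\delta_k=1\}$, $m=2p_{01}+p_0+p_1$, and $W=\lim_{n\to\infty}|\mathbb{G}_n^*|/m^n$ (a.s. limit, a non-negative square-integrable random variable). Assumptions. (H.1) $(\varepsilon_{2k},\eta_{2k},\varepsilon_{2k+1},\eta_{2k+1})_{k\ge1}$ is i.i.d. and independent of $X_1$. (H.2) For some $\gamma\ge1$,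 $\varepsilon_2,\eta_2,\varepsilon_3,\eta_3,X_1$ have moments of all orders up to $4\gamma$, and $\mathbb{E}[\varepsilon_2]=\mathbb{E}[\varepsilon_3]=0$, $\mathbb{E}[\varepsilon_2^2]=\mathbb{E}[\varepsilon_3^2]=\sigma_\varepsilon^2>0$, $\mathbb{E}[\varepsilon_2\varepsilon_3]=\rho_\varepsilon$, $\mathbb{E}[\eta_2]=\mathbb{E}[\eta_3]=0$, $\mathbb{E}[\eta_2^2]=\mathbb{E}[\eta_3^2]=\sigma_\eta^2>0$, $\mathbb{E}[\eta_2\eta_3]=\rho_\eta$, $\mathbb{E}[\varepsilon_{2+i}\eta_{2+j}]=\rho_{ij}$ for $i,j\in\{0,1\}$. (H.3) $(\xi_k^0,\xi_k^1)_{k\ge1}$ is independent of $(\varepsilon_{2k},\eta_{2k},\varepsilon_{2k+1},\eta_{2k+1})_{k\ge1}$ and of $X_1$. (H.4) $m>1$. (H.5) There exists $\kappa$ with $1\le\kappa\le\gamma$ and $\frac{p_0+p_{01}}{m}\mathbb{E}[|b+\eta_2|^{4\kappa}]+\frac{p_1+p_{01}}{m}\mathbb{E}[|d+\eta_3|^{4\kappa}]<1$. Cemetery point. $\overline{\mathbb{R}}=\mathbb{R}\cup\{\partial\}$, and $X_k^*=X_k$ if $\delta_k=1$, $X_k^*=\partial$ if $\delta_k=0$. Class $F_q$. $F_q$ is the vector space of functions on $\overline{\mathbb{R}}^3$ generated by $x^\alpha y^\beta\mathbf{1}_{\mathbb{R}}(y)$, $x^\alpha z^\tau\mathbf{1}_{\mathbb{R}}(z)$,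 $x^\alpha y^\beta z^\tau\mathbf{1}_{\mathbb{R}^2}(y,z)$ with non-negative integers $\alpha,\beta,\tau$ such that $\alpha+\beta+\tau\le q$ (a product containing a zero indicator is zero). Kernel $P$. For measurable $f:\overline{\mathbb{R}}^3\to\mathbb{R}$ and $x\in\mathbb{R}$, whenever the expectations exist, $$Pf(x)=p_{01}\mathbb{E}[f(x,(b+\eta_2)x+a+\varepsilon_2,(d+\eta_3)x+c+\varepsilon_3)]+p_0\mathbb{E}[f(x,(b+\eta_2)x+a+\varepsilon_2,\partial)]+p_1\mathbb{E}[f(x,\partial,(d+\eta_3)x+c+\varepsilon_3)]+(1-p_{01}-p_0-p_1)f(x,\partial,\partial).$$ Invariant law $\mu$. Let $\zeta$ be Bernoulli with mean $(p_{01}+p_1)/m$, independent of $(\varepsilon_2,\eta_2,\varepsilon_3,\eta_3)$, and $(A_n,B_n)_{n\ge1}$ i.i.d. copies of $(a_{2+\zeta}+\varepsilon_{2+\zeta},\,b_{2+\zeta}+\eta_{2+\zeta})$. $\mu$ is the law on $\mathbb{R}$ of the a.s. convergent series $Y_\infty=\sum_{\ell\ge1}B_1\cdots B_{\ell-1}A_\ell$, and $\langle\mu,g\rangle=\int g\,d\mu$. *)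

(* Defs.v *)
From HB Require Import structures.
From mathcomp Require Import all_boot all_order all_algebra.
From mathcomp Require Import all_classical all_reals all_analysis.
From mathcomp Require Import measurable_realfun.
Import Order.TTheory GRing.Theory Num.Theory.
Import numFieldNormedType.Exports.

Set Implicit Arguments.
Unset Strict Implicit.
Unset Printing Implicit Defensive.

Local Open Scope classical_set_scope.
Local Open Scope ring_scope.

Definition events {disp disp'} {T : measurableType disp}
    {T' : measurableType disp'} (X : T -> T') : set (set T) :=
  preimage_set_system setT X measurable.

(* Sequences are indexed by the positive integers; the value at 0 is ignored *)
Definition events_seq {disp disp'} {T : measurableType disp}
    {T' : measurableType disp'} (X : nat -> T -> T') : set (set T) :=
  \bigcup_(k in [set k | (0 < k)%N]) events (X k).

Definition independent {disp} {T : measurableType disp} {R : realType}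
    (P : probability T R) (F G : set (set T)) : Prop :=
  forall A B, <<s F >> A -> <<s G >> B -> P (A `&` B) = (P A * P B)%E.

Definition mutually_independent {disp disp'} {T : measurableType disp}
    {T' : measurableType disp'} {R : realType} (P : probability T R)
    (X : nat -> T -> T') : Prop :=
  forall (s : seq nat) (E : nat -> set T'),
    uniq s -> (forall k, k \in s -> (0 < k)%N) ->
    (forall k, k \in s -> measurable (E k)) ->
    P (\bigcap_(k in [set` s]) (X k @^-1` E k)) =
      (\prod_(k <- s) P (X k @^-1` E k))%E.

Definition iid {disp disp'} {T : measurableType disp}
    {T' : measurableType disp'} {R : realType} (P : probability T R)
    (X : nat -> T -> T') : Prop :=
  mutually_independent P X /\
  forall k E, (0 < k)%N -> measurable E ->
    P (X k @^-1` E) = P (X 1%N @^-1` E).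

Definition finite_moments {disp} {T : measurableType disp} {R : realType}
    (P : probability T R) (q : R) (Z : T -> R) : Prop :=
  forall r : R, 0 <= r <= q -> ('E_P[fun w => (`|Z w| `^ r)%R] < +oo)%E.

Definition noise {T : Type} {R : realType} (eps eta : nat -> T -> R) (k : nat)
    (w : T) : R * R * R * R :=
  (eps (2 * k)%N w, eta (2 * k)%N w,
   eps (2 * k + 1)%N w, eta (2 * k + 1)%N w).

(* The observed individuals of generation n, i.e. G_n^* *)
Definition observed {T : Type} (delta : nat -> T -> bool) (n : nat) (w : T) :
    seq nat :=
  [seq k <- index_iota (2 ^ n) (2 ^ n.+1) | delta k w].

(* The limit W; [limn] is total, with a fixed default value on divergence *)
Definition population_limit {T : Type} {R : realType}
    (delta : nat -> T -> bool) (m : R) (w : T) : R :=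
  limn (fun n => (size (observed delta n w))%:R / m ^+ n : R).

(* [option R] is the real line with the cemetery point [None] *)
Definition killed {T : Type} {R : realType} (X : nat -> T -> R)
    (delta : nat -> T -> bool) (k : nat) (w : T) : option R :=
  if delta k w then Some (X k w) else None.

(* x^n 1_R(x), also for n = 0 *)
Definition cpow {R : realType} (x : option R) (n : nat) : R :=
  if x is Some r then r ^+ n else 0.

(* In all three cases the value at x = None is set to 0; the class is only
   ever evaluated at x in R. *)
Definition Fgen {R : realType} (q : R) :
    set (option R -> option R -> option R -> R) :=
  [set g | exists al be ta : nat, (al + be + ta)%:R <= q /\
    [\/ g = (fun x y z => cpow x al * cpow y be),
        g = (fun x y z => cpow x al * cpow z ta) |
        g = (fun x y z => cpow x al * cpow y be * cpow z ta)]].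

Definition Fclass {R : realType} (q : R) :
    set (option R -> option R -> option R -> R) :=
  [set f | exists (n : nat) (coef : 'I_n -> R)
             (g : 'I_n -> option R -> option R -> option R -> R),
    (forall i, Fgen q (g i)) /\
    forall x y z, f x y z = \sum_(i < n) coef i * g i x y z].

Definition kernelP {disp} {T : measurableType disp} {R : realType}
    (P : probability T R) (a b c d p0 p1 p01 : R) (eps eta : nat -> T -> R)
    (f : option R -> option R -> option R -> R) (x : R) : \bar R :=
  let Y w := Some ((b + eta 2%N w) * x + a + eps 2%N w) in
  let Z w := Some ((d + eta 3%N w) * x + c + eps 3%N w) in
  (p01%:E * 'E_P[fun w => f (Some x) (Y w) (Z w)]
   + p0%:E * 'E_P[fun w => f (Some x) (Y w) None]
   + p1%:E * 'E_P[fun w => f (Some x) None (Z w)]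
   + ((1 - p01 - p0 - p1) * f (Some x) None None)%R%:E)%E.

(* (a_{2+zeta} + eps_{2+zeta}, b_{2+zeta} + eta_{2+zeta}) on the product space
   bool * T, where zeta is the first projection *)
Definition mixed_pair {T : Type} {R : realType} (a b c d : R)
    (eps eta : nat -> T -> R) (zw : bool * T) : R * R :=
  ((if zw.1 then c else a) + eps (2 + zw.1)%N zw.2,
   (if zw.1 then d else b) + eta (2 + zw.1)%N zw.2).

Definition perpetuity_partial {disp} {T : measurableType disp} {R : realType}
    (A B : nat -> {mfun T >-> R}) (n : nat) (w : T) : R :=
  \sum_(1 <= l < n.+1) (\prod_(1 <= j < l) B j w) * A l w.

Definition perpetuity {disp} {T : measurableType disp} {R : realType}
    (A B : nat -> {mfun T >-> R}) (w : T) : R :=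
  limn (fun n => perpetuity_partial A B n w).

Lemma measurable_fun_limn_real {disp} {T : measurableType disp}
    {R : realType} (u : nat -> T -> R) :
  (forall n, measurable_fun setT (u n)) ->
  measurable_fun setT (fun w => limn (fun n => u n w)).
Proof.
move=> mu.
pose C := \bigcap_k \bigcup_N \bigcap_(n in [set n | (N <= n)%N])
   \bigcap_(p in [set p | (N <= p)%N])
   [set w | `|u n w - u p w| < k.+1%:R^-1].
have mC : measurable C.
  apply: bigcapT_measurable => k; apply: bigcupT_measurable => N.
  apply: bigcap_measurable => [|n _]; first by exists N => /=.
  apply: bigcap_measurable => [|p _]; first by exists N => /=.
  rewrite -[X in measurable X]setTI.
  have : measurable_fun setT (fun w => `|u n w - u p w|).
    by apply: measurableT_comp => //; apply: measurable_funB.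
  move=> /(_ measurableT `]-oo, k.+1%:R^-1[%classic (measurable_itv _)).
  by congr measurable; congr (_ `&` _); apply/seteqP; split => w /=;
    rewrite in_itv.
have CP w : C w <-> cvgn (fun n => u n w).
  split=> [Cw|/cvg_ex[l /cvgrPdist_lt cu] k _].
    apply/cauchy_cvgP/pseudometric_structure.cauchyP => e e0.
    have [k _ /(_ k (leqnn k)) /= ke] := near_infty_natSinv_lt (PosNum e0).
    have [N _ CN] := Cw k I.
    exists (u N w); exists N => // n /= Nn.
    by rewrite /ball /=; apply: lt_trans ke; exact: (CN N (leqnn N) n Nn).
  have [|N _ lN] := cu (k.+1%:R^-1 / 2); first by rewrite divr_gt0// invr_gt0.
  exists N => // n /= Nn p /= Np.
  have := lN n Nn; have := lN p Np => /= h1 h2.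
  rewrite (_ : u n w - u p w = (l - u p w) - (l - u n w)).
    by rewrite (splitr k.+1%:R^-1) (le_lt_trans (ler_normB _ _))// ltrD.
  by rewrite opprB [RHS]addrC addrA subrK.
rewrite -(setUv C); apply/measurable_funU => //; first exact: measurableC.
split.
  apply: (measurable_fun_cvg (h := u)) => [n|w Cw].
    exact: measurable_funTS.
  exact/CP.
apply: (eq_measurable_fun (cst point)); last exact: measurable_cst.
move=> w; rewrite inE => nCw /=.
by rewrite dvgP// => /CP.
Qed.

Section perpetuity_mfun.
Context {disp} {T : measurableType disp} {R : realType}.
Variables A B : nat -> {mfun T >-> R}.

Let mperpetuity : measurable_fun setT (perpetuity A B).
Proof.
apply: measurable_fun_limn_real => n.
apply: measurable_sum => l; apply: measurable_funM => //.
exact: measurable_prod.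
Qed.

HB.instance Definition _ :=
  isMeasurableFun.Build _ _ _ _ (perpetuity A B) mperpetuity.

End perpetuity_mfun.

(* Main.v *)
Require Import Defs.
From HB Require Import structures.
From mathcomp Require Import all_boot all_order all_algebra.
From mathcomp Require Import all_classical all_reals all_analysis.
From mathcomp Require Import measurable_realfun.
From mathcomp Require Import ring lra.
Import Order.TTheory GRing.Theory Num.Theory.
Import numFieldNormedType.Exports.

(** For an observed individual k write Z_k for the fresh randomness attached
    to k: its noise and the two marks deciding which children are observed.
    Every f in the class F_kappa is a polynomial, so f(X*_k, X*_2k, X*_2k+1)
    is a polynomial in X_k of degree at most q, the integer part of kappa,
    whose coefficients are square integrable functions h_i(Z_k)
    ([Fclass_poly]); and Pf(x) is the sum of the E[h_i] x^i ([kernelP_poly]).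
    The theorem thus concerns the weighted power sums
    S_j(n) = m^-n sum_{k in G*_n} X_k^j ([power_mean]), and rests on two facts.

    First, h_i(Z_k) may be replaced by its mean.  Since Z_k is independent of
    X_1 and of all the other Z_l, the terms X_k^i (h(Z_k) - E h) with k in
    G*_n are centred and orthogonal, so that m^-n times their sum has variance
    m^-n Var(h) E[S_2i(n)].  As E[S_2i(n)] is bounded for i <= q, this is
    summable in n, and the fluctuations are almost surely absolutely summable
    ([fluctuation_summable]).

    Secondly, S_j(n) tends to l_j W for j <= q, where l_j is the j-th moment of
    mu ([power_mean_cvg]).  Expand X_2k^j and X_2k+1^j in powers of X_k and
    replace the coefficients by their means: the first fact gives
    S_j(n+1) = sum_{i <= j} c_ji S_i(n) + o(1).  Here c_00 = 1, and the o(1) is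
    summable, so S_0 converges, and W is by definition its limit.  For j >= 1
    the condition (H.5) and Young's inequality give |c_jj| < 1, and an
    induction on j shows that S_j - l_j W tends to 0 as soon as l solves
    l_j = sum_{i <= j} c_ji l_i with l_0 = 1 ([triangular_cvg0]).  The same
    recursion for expectations, with no error term, bounds E[S_2i(n)]
    ([power_mean_bounded]).

    The moments of mu solve these equations: c_ji is the coefficient of x^i in
    E[(A_1 + B_1 x)^j], and the partial sums of the perpetuity satisfy
    Y_n+1 = A_1 + B_1 Y'_n with Y'_n independent of (A_1, B_1).  The same
    recursion for (|A|, |B|) bounds the moments of the sums of absolute values,
    which yields both the almost sure convergence of the series and the
    domination needed to pass to the limit in the moments
    ([perpetuity_moment], [perpetuity_moment_fixpoint]). *)

Set Implicit Arguments.
Unset Strict Implicit.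
Unset Printing Implicit Defensive.

Local Open Scope classical_set_scope.
Local Open Scope ring_scope.

(** * Linear recursions *)

Section recursions.
Context {R : realType}.

Lemma cvg_bigsum (I : Type) (r : seq I) (f : I -> nat -> R) (l : I -> R) :
  (forall i, f i n @[n --> \oo] --> l i) ->
  \sum_(i <- r) f i n @[n --> \oo] --> \sum_(i <- r) l i.
Proof.
by move=> fl; apply: cvg_big => //; exact: add_continuous.
Qed.

Lemma contraction_bounded (u : nat -> R) (rho C : R) :
  0 <= rho < 1 -> (forall n, `|u n.+1| <= rho * `|u n| + C) ->
  exists M, forall n, `|u n| <= M.
Proof.
move=> /andP[r0 r1] h.
have s0 : 0 < 1 - rho by rewrite subr_gt0.
exists (Num.max `|u 0%N| (C / (1 - rho))).
elim=> [|n ih]; first by rewrite le_max lexx.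
apply: (le_trans (h n)); set M := Num.max _ _ in ih *.
have CM : C <= (1 - rho) * M by rewrite mulrC -ler_pdivrMr// le_max lexx orbT.
have : rho * `|u n| <= rho * M by rewrite ler_wpM2l.
move=> h2; rewrite (_ : M = rho * M + (1 - rho) * M); last by ring.
exact: lerD.
Qed.

Lemma contraction_cvg0 (u e : nat -> R) (rho : R) :
  0 <= rho < 1 -> (forall n, `|u n.+1| <= rho * `|u n| + `|e n|) ->
  e @ \oo --> 0 -> u @ \oo --> 0.
Proof.
move=> /andP[r0 r1] h e0.
have s0 : 0 < 1 - rho by rewrite subr_gt0.
apply/cvgr0Pnorm_le => eps eps0.
have eps20 : 0 < eps / 2 by rewrite divr_gt0.
have d0 : 0 < (1 - rho) * (eps / 2) by rewrite mulr_gt0.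
have /cvgr0Pnorm_le/(_ _ d0)[N _ HN] := e0.
have key k : `|u (N + k)%N| <= rho ^+ k * `|u N| + eps / 2.
  elim: k => [|k ih]; first by rewrite addn0 expr0 mul1r lerDl ltW.
  rewrite addnS (le_trans (h _))//.
  have := HN (N + k)%N (leq_addr _ _) => /= h1.
  have := ler_wpM2l r0 ih; rewrite exprS; lra.
have : (fun k => rho ^+ k * `|u N|) @ \oo --> 0.
  rewrite -[X in _ --> X](mul0r `|u N|); apply: cvgMl.
  by apply: cvg_expr; rewrite ger0_norm.
move=> /cvgr0Pnorm_le/(_ _ eps20)[K _ HK].
exists (N + K)%N => // n /= Kn.
have Nn : (N <= n)%N by apply: leq_trans Kn; rewrite leq_addr.
rewrite -(subnKC Nn) (le_trans (key _))//.
have := HK (n - N)%N _; rewrite /= leq_subRL// => /(_ Kn).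
move=> /(le_trans (ler_norm _)); lra.
Qed.

(** Induction on j: the terms of index below j form a bounded perturbation of
    a contraction of ratio |c_jj|.  Only the row j = 0, where the ratio may
    be 1, has to be bounded by hypothesis. *)
Lemma triangular_bounded (s : nat -> nat -> R) (c : nat -> nat -> R) (K : nat) :
  (forall j n, (j <= K)%N -> s j n.+1 = \sum_(i < j.+1) c j i * s i n) ->
  (forall j, (0 < j <= K)%N -> `|c j j| < 1) ->
  (exists M, forall n, `|s 0%N n| <= M) ->
  forall j, (j <= K)%N -> exists M, forall n, `|s j n| <= M.
Proof.
move=> sE c1 s0; elim/ltn_ind => -[//|j] ih jK.
have /choice[M HM] : forall i : 'I_j.+1, exists M, forall n, `|s i n| <= M.
  by move=> i; apply: ih => //; exact: leq_trans (ltnW (ltn_ord i)) jK.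
apply: (@contraction_bounded _ `|c j.+1 j.+1|
   (\sum_(i < j.+1) `|c j.+1 i| * M i)) => [|n].
  by rewrite normr_ge0 c1.
rewrite sE// big_ord_recr/= addrC (le_trans (ler_normD _ _))// normrM lerD2l.
rewrite (le_trans (ler_norm_sum _ _ _))// ler_sum// => i _.
by rewrite normrM ler_wpM2l.
Qed.

(** Same induction as for boundedness, the perturbation now tending to 0. *)
Lemma triangular_cvg0 (t e : nat -> nat -> R) (c : nat -> nat -> R) (K : nat) :
  (forall j n, (j <= K)%N ->
     t j n.+1 = \sum_(i < j.+1) c j i * t i n + e j n) ->
  (forall j, (0 < j <= K)%N -> `|c j j| < 1) ->
  (forall j, (j <= K)%N -> e j @ \oo --> 0) ->
  t 0%N @ \oo --> 0 ->
  forall j, (j <= K)%N -> t j @ \oo --> 0.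
Proof.
move=> tE c1 e0 t0; elim/ltn_ind => -[//|j] ih jK.
apply: (@contraction_cvg0 _
  (fun n => \sum_(i < j.+1) c j.+1 i * t i n + e j.+1 n) `|c j.+1 j.+1|).
- by rewrite normr_ge0 c1.
- move=> n; rewrite tE// big_ord_recr/= addrAC addrC -normrM.
  exact: ler_normD.
- rewrite -[X in _ --> X]addr0; apply: cvgD; last exact: e0.
  rewrite [X in _ --> X](_ : _ = \sum_(i < j.+1) c j.+1 i * 0); last first.
    by rewrite big1// => i _; rewrite mulr0.
  apply: (@cvg_bigsum _ _ (fun (i : 'I_j.+1) n => c j.+1 i * t i n)
    (fun i => c j.+1 i * 0)) => i; apply: cvgMr; apply: ih => //.
  exact: leq_trans (ltnW (ltn_ord i)) jK.
Qed.

End recursions.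

(** * Independence *)

Section independence.
Context {disp} {T : measurableType disp} {R : realType}.
Variable P : probability T R.
Implicit Types F G : set (set T).

Lemma g_sigma_measurable F : F `<=` measurable -> <<s F >> `<=` measurable.
Proof. by move=> mF; apply: smallest_sub => //; exact: sigma_algebra_measurable. Qed.

(** Dynkin's argument: for a fixed B the events A satisfying the product rule
    form a lambda-system. *)
Lemma independent_event F B : setI_closed F -> F `<=` measurable ->
  measurable B -> (forall A, F A -> P (A `&` B) = P A * P B)%E ->
  forall A, <<s F >> A -> P (A `&` B) = (P A * P B)%E.
Proof.
move=> IF mF mB FB; have msF := g_sigma_measurable mF.
apply: (@dynkin_induction _ (g_sigma_algebraType F) F
  (fun A => P (A `&` B) = P A * P B)%E) => //.
- by rewrite setTI probability_setT mul1e.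
- move=> A /msF mA AB.
  rewrite setIC -setDE measureD//; last by rewrite ltey_eq fin_num_measure.
  rewrite setIC; transitivity (P B - P A * P B)%E; first by congr (_ - _)%E.
  have [pA pB] : (P A \is a fin_num) /\ (P B \is a fin_num).
    by split; exact: fin_num_measure.
  rewrite probability_setC//; move: pA pB.
  by case: (P A) => [x||]//; case: (P B) => [y||]// _ _; congr EFin => /=; ring.
- move=> /= E mE tE EB.
  have mE' n : @measurable _ T (E n) by apply: (msF (E n)); exact: mE.
  rewrite setI_bigcupl measure_bigcup//=; last 2 first.
  + by move=> n _; exact: measurableI.
  + exact: trivIset_setIr.
  rewrite measure_bigcup//= muleC -(fineK (fin_num_measure P _ mB)).
  rewrite -nneseriesZl//; apply: eq_eseriesr => n _.
  by rewrite EB fineK ?fin_num_measure// muleC.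
Qed.

Lemma independent_setI F G : setI_closed F -> setI_closed G ->
  F `<=` measurable -> G `<=` measurable ->
  (forall A B, F A -> G B -> P (A `&` B) = P A * P B)%E ->
  independent P F G.
Proof.
move=> IF IG mF mG FG A B sA sB.
apply: (independent_event IF) => //; first exact: (g_sigma_measurable mG).
move=> {sA}A FA; rewrite setIC muleC.
apply: (independent_event IG) => // [|{sB}B GB]; first exact: mF.
by rewrite setIC muleC; exact: FG.
Qed.

Lemma independent_sub F G F' G' : F' `<=` <<s F >> -> G' `<=` <<s G >> ->
  independent P F G -> independent P F' G'.
Proof.
move=> FF GG FG A B sA sB; apply: FG.
- by apply: (smallest_sub _ FF) sA; exact: smallest_sigma_algebra.
- by apply: (smallest_sub _ GG) sB; exact: smallest_sigma_algebra.
Qed.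

Lemma independentC F G : independent P F G -> independent P G F.
Proof. by move=> FG A B sA sB; rewrite setIC muleC FG. Qed.

(** The sets A `&` B form the pi-system through which the sigma-algebra of a
    union of two systems is reached. *)
Lemma setI_closed_meets F G :
  setI_closed [set A `&` B | A in <<s F >> & B in <<s G >>].
Proof.
move=> _ _ [A sA [B sB <-]] [A' sA' [B' sB' <-]].
exists (A `&` A'); first exact: (@measurableI _ (g_sigma_algebraType F)).
exists (B `&` B'); first exact: (@measurableI _ (g_sigma_algebraType G)).
by rewrite setIACA.
Qed.

(** Regrouping independent systems: when the F's are independent of the G's,
    independence inside each family gives that of the mixed pairs, because
    P (A1 A2 B1 B2) = P (A1 A2) P (B1 B2) on the generating pi-systems. *)
Lemma independent_setU F1 F2 G1 G2 :
  F1 `|` F2 `<=` measurable -> G1 `|` G2 `<=` measurable ->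
  independent P F1 F2 -> independent P G1 G2 ->
  independent P (F1 `|` F2) (G1 `|` G2) ->
  independent P (F1 `|` G1) (F2 `|` G2).
Proof.
move=> mF mG F12 G12 FG.
have mF1 : <<s F1 >> `<=` measurable.
  by apply: g_sigma_measurable => A FA; apply: mF; left.
have mF2 : <<s F2 >> `<=` measurable.
  by apply: g_sigma_measurable => A FA; apply: mF; right.
have mG1 : <<s G1 >> `<=` measurable.
  by apply: g_sigma_measurable => A FA; apply: mG; left.
have mG2 : <<s G2 >> `<=` measurable.
  by apply: g_sigma_measurable => A FA; apply: mG; right.
have sub (H K : set (set T)) : H `|` K `<=`
    <<s [set A `&` B | A in <<s H >> & B in <<s K >>] >>.
  move=> A [HA|KA]; apply: sub_sigma_algebra.
    exists A; first exact: sub_sigma_algebra.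
    by exists setT; [exact: (@measurableT _ (g_sigma_algebraType K))|
                     rewrite setIT].
  exists setT; first exact: (@measurableT _ (g_sigma_algebraType H)).
  by exists A; [exact: sub_sigma_algebra|rewrite setTI].
have sl (H K : set (set T)) : <<s H >> `<=` <<s H `|` K >>.
  by apply: sub_sigma_algebra2; exact: subsetUl.
have sr (H K : set (set T)) : <<s K >> `<=` <<s H `|` K >>.
  by apply: sub_sigma_algebra2; exact: subsetUr.
have UI (H K : set (set T)) A B : <<s H >> A -> <<s K >> B ->
    <<s H `|` K >> (A `&` B).
  move=> HA KB; apply: (@measurableI _ (g_sigma_algebraType (H `|` K))).
    exact: sl HA.
  exact: sr KB.
have FG' A B : <<s F1 `|` F2 >> A -> <<s G1 `|` G2 >> B ->
  P (A `&` B) = (P A * P B)%E by exact: FG.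
apply: (independent_sub (@sub F1 G1) (@sub F2 G2)).
apply: independent_setI; [exact: setI_closed_meets|exact: setI_closed_meets| | |].
- by move=> _ [A sA [B sB <-]]; apply: measurableI; [exact: mF1|exact: mG1].
- by move=> _ [A sA [B sB <-]]; apply: measurableI; [exact: mF2|exact: mG2].
move=> _ _ [A sA [B sB <-]] [A' sA' [B' sB' <-]].
rewrite setIACA FG'; [|exact: UI|exact: UI].
rewrite (F12 _ _ sA sA') (G12 _ _ sB sB').
rewrite (FG' A B); [|exact: sl|exact: sl].
rewrite (FG' A' B'); [|exact: sr|exact: sr].
exact: muleACA.
Qed.

(** The law of (U, V) is the product of the two laws, so that the expectation
    of the product is computed by Fubini's theorem. *)
Lemma preimage_independent_expectationM (U V : T -> R) :
  measurable_fun setT U -> measurable_fun setT V ->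
  (forall A B, measurable A -> measurable B ->
     P (U @^-1` A `&` V @^-1` B) = P (U @^-1` A) * P (V @^-1` B))%E ->
  P.-integrable setT (EFin \o U) -> P.-integrable setT (EFin \o V) ->
  P.-integrable setT (EFin \o (fun w => U w * V w)) /\
  \int[P]_w (U w * V w) = \int[P]_w U w * \int[P]_w V w.
Proof.
move=> mU mV UV iU iV.
pose U' : {mfun T >-> R} := HB.pack U (isMeasurableFun.Build _ _ _ _ U mU).
pose V' : {mfun T >-> R} := HB.pack V (isMeasurableFun.Build _ _ _ _ V mV).
pose W w := (U w, V w).
have mW : measurable_fun setT W by exact/measurable_fun_pair.
pose W' : {mfun T >-> (R * R)%type} := HB.pack W (isMeasurableFun.Build _ _ _ _ W mW).
pose mu := distribution P U'; pose nu := distribution P V'.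
have muE A : measurable A -> (mu \x nu)%E A = distribution P W' A.
  apply: product_measure_unique => B C mB mC.
  by rewrite /= /distribution /pushforward /= -UV.
pose f (z : R * R) : \bar R := (z.1 * z.2)%:E.
have mf : measurable_fun setT f.
  apply/measurable_EFinP; apply: measurable_funM.
    exact: measurable_fst.
  exact: measurable_snd.
have mabsf : measurable_fun setT (fun z => `|f z|%E).
  apply/measurable_EFinP; apply: (measurableT_comp (@normr_measurable R _)).
  by apply: measurable_funM; [exact: measurable_fst|exact: measurable_snd].
have mabs : measurable_fun setT (fun x : R => `|x|%:E).
  by apply/measurable_EFinP; exact: normr_measurable.
have abs_lty (V0 : {mfun T >-> R}) : P.-integrable setT (EFin \o V0) ->
    (\int[distribution P V0]_x `|x|%:E < +oo)%E.
  move=> /integrableP[_]; apply: le_lt_trans.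
  by rewrite ge0_integral_distribution//= => y; rewrite lee_fin.
have i12 : (mu \x nu)%E.-integrable setT f.
  apply/integrableP; split => //.
  rewrite fubini_tonelli1//=.
  rewrite /fubini_F /=.
  under eq_integral => x _.
    under eq_integral => y _ do rewrite normrM EFinM.
    rewrite ge0_integralZl//=.
    over.
  by rewrite ge0_integralZr//= ?lte_mul_pinfty ?abs_lty//= ?ge0_fin_numE ?abs_lty
    ?integral_ge0.
have iUV : P.-integrable setT (EFin \o (fun w => U w * V w)).
  apply/integrableP; split.
    by apply/measurable_EFinP; exact: measurable_funM.
  have := ge0_integral_distribution W' (f := fun z => `|f z|%E).
  rewrite /comp /= => <-//.
  rewrite (eq_measure_integral (mu \x nu)%E) => [|A mA _]; last first.
    exact/esym/muE.
  by have /integrableP[] := i12.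
split => //.
have -> : \int[P]_w (U w * V w) = fine (\int[(mu \x nu)%E]_z f z)%E.
  congr fine.
  rewrite (eq_measure_integral (distribution P W')) => [|A mA _]; last exact: muE.
  by rewrite integral_distribution.
rewrite -integral12_prod_meas1// /fubini_F /=.
have iV' : nu.-integrable setT EFin.
  apply/integrableP; split; first exact/measurable_EFinP.
  exact: abs_lty.
have iU' : mu.-integrable setT EFin.
  apply/integrableP; split; first exact/measurable_EFinP.
  exact: abs_lty.
under eq_integral => x _.
  under eq_integral => y _ do rewrite /f /= EFinM.
  rewrite integralZl//=.
  over.
have fV : (\int[nu]_y y%:E)%E \is a fin_num by exact: integrable_fin_num.
rewrite -(fineK fV) integralZr//= fineM//; last exact: integrable_fin_num.
by rewrite /Rintegral !integral_distribution//; exact/measurable_EFinP.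
Qed.

Lemma independent_expectationM F G (U V : T -> R) :
  F `<=` measurable -> G `<=` measurable -> independent P F G ->
  measurable_fun setT (U : g_sigma_algebraType F -> R) ->
  measurable_fun setT (V : g_sigma_algebraType G -> R) ->
  P.-integrable setT (EFin \o U) -> P.-integrable setT (EFin \o V) ->
  P.-integrable setT (EFin \o (fun w => U w * V w)) /\
  \int[P]_w (U w * V w) = \int[P]_w U w * \int[P]_w V w.
Proof.
move=> mF mG FG mU mV iU iV.
apply: preimage_independent_expectationM => //.
- by have /measurable_int/measurable_EFinP := iU.
- by have /measurable_int/measurable_EFinP := iV.
- move=> A B mA mB; apply: FG.
  + by have := mU measurableT A mA; rewrite setTI.
  + by have := mV measurableT B mB; rewrite setTI.
Qed.

Section blocks.
Context {disp'} {T' : measurableType disp'}.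
Variable X : nat -> T -> T'.
Hypothesis mX : forall k, (0 < k)%N -> measurable_fun setT (X k).
Implicit Types K L : set nat.

Definition events_on K : set (set T) := \bigcup_(k in K) events (X k).

(** The pi-system generating the sigma-algebra of the X k, k in K. *)
Definition cylinders K : set (set T) :=
  [set A | exists (s : seq nat) (E : nat -> set T'),
    [/\ uniq s, (forall k, k \in s -> K k /\ (0 < k)%N),
        (forall k, measurable (E k)) &
        A = \bigcap_(k in [set` s]) (X k @^-1` E k)]].

Let mXE k E : (0 < k)%N -> measurable E -> measurable (X k @^-1` E).
Proof. by move=> k0 mE; rewrite -[_ @^-1` _]setTI; exact: mX. Qed.

Lemma measurable_events_on K : K `<=` [set k | (0 < k)%N] ->
  events_on K `<=` measurable.
Proof. by move=> K0 _ [k /K0 k0 [B mB <-]]; exact: mX. Qed.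

Lemma measurable_cylinders K : cylinders K `<=` measurable.
Proof.
move=> _ [s [E [_ sK mE ->]]]; apply: bigcap_measurableType => k /= /sK[_ k0].
exact: mXE.
Qed.

Lemma bigcap_preimage_cat (s s' : seq nat) (E E' : nat -> set T') :
  (\bigcap_(k in [set` s]) (X k @^-1` E k)) `&`
  (\bigcap_(k in [set` s']) (X k @^-1` E' k)) =
  \bigcap_(k in [set` s ++ s']) (X k @^-1`
     ((if k \in s then E k else setT) `&` (if k \in s' then E' k else setT))).
Proof.
apply/seteqP; split=> [w [sw s'w] k /= _|w sw].
  split; first by case: ifPn => // ks; exact: sw.
  by case: ifPn => // ks; exact: s'w.
by split=> k /= ks; have := sw k; rewrite /= mem_cat ks ?orbT => /(_ isT)[].
Qed.

Lemma setI_closed_cylinders K : setI_closed (cylinders K).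
Proof.
move=> _ _ [s [E [us sK mE ->]]] [s' [E' [us' sK' mE' ->]]].
rewrite bigcap_preimage_cat; exists (undup (s ++ s')).
exists (fun k => (if k \in s then E k else setT) `&`
  (if k \in s' then E' k else setT)); split.
- exact: undup_uniq.
- by move=> k; rewrite mem_undup mem_cat => /orP[/sK|/sK'].
- by move=> k; apply: measurableI; case: ifPn.
- by apply: eq_bigcapl; split=> k /=; rewrite mem_undup.
Qed.

(** The product rule for a cylinder over K and a cylinder over L is the one for
    the concatenation of their index lists. *)
Lemma mutually_independent_disjoint K L : mutually_independent P X ->
  K `<=` [set k | (0 < k)%N] -> L `<=` [set k | (0 < k)%N] ->
  K `&` L = set0 -> independent P (events_on K) (events_on L).
Proof.
move=> iX K0 L0 KL.
have sub M : M `<=` [set k | (0 < k)%N] ->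
    events_on M `<=` <<s cylinders M >>.
  move=> M0 _ [k Mk [B mB <-]]; apply: sub_sigma_algebra.
  exists [:: k], (fun=> B); split => //.
    by move=> i; rewrite inE => /eqP ->; split => //; exact: M0.
  rewrite setTI; apply/seteqP; split=> [w Bw i /=|w /(_ k)]; last first.
    by apply; rewrite /= inE.
  by rewrite inE => /eqP ->.
apply: (independent_sub (sub _ K0) (sub _ L0)).
apply: independent_setI; [exact: setI_closed_cylinders|
  exact: setI_closed_cylinders|exact: measurable_cylinders|
  exact: measurable_cylinders|].
move=> _ _ [s [E [us sK mE ->]]] [s' [E' [us' sL mE' ->]]].
have ss' k : k \in s -> k \in s' = false.
  move=> ks; apply/negP => ks'.
  have : (K `&` L) k by split; [exact: (sK k ks).1|exact: (sL k ks').1].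
  by rewrite KL.
rewrite bigcap_preimage_cat !iX//.
- rewrite big_cat/=; congr (_ * _)%E; apply: eq_big_seq => k ks.
    by rewrite ks ss'// setIT.
  rewrite ks (_ : k \in s = false) ?setTI//.
  by apply/negP => /ss'; rewrite ks.
- by move=> k /sL[].
- by move=> k /sK[].
- rewrite cat_uniq us us' andbT /=; apply/hasPn => k ks'.
  by apply/negP => /ss'; rewrite ks'.
- by move=> k; rewrite mem_cat => /orP[/sK[]|/sL[]].
- by move=> k _; apply: measurableI; case: ifPn.
Qed.

End blocks.

End independence.

(** * Almost sure summability *)

Section almost_sure.
Context {disp} {T : measurableType disp} {R : realType}.
Variable P : probability T R.

(** By monotone convergence the sum of the series is integrable, hence finite
    almost everywhere. *)
Lemma ae_cvg_series_ge0 (f : nat -> T -> R) (C : R) :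
  (forall n, measurable_fun setT (f n)) -> (forall n w, 0 <= f n w) ->
  (forall N, \int[P]_w (\sum_(0 <= n < N) f n w)%:E <= C%:E)%E ->
  {ae P, forall w, cvgn (series (fun n => f n w))}.
Proof.
move=> mf f0 fC; pose g w := (\sum_(0 <= n <oo) (f n w)%:E)%E.
have mg : measurable_fun setT g.
  by apply: ge0_emeasurable_sum => [k x _ _|k _];
    [rewrite lee_fin|exact/measurable_EFinP].
have g0 w : (0 <= g w)%E by apply: nneseries_ge0 => n _ _; rewrite lee_fin.
have ig : P.-integrable setT g.
  apply/integrableP; split => //.
  under eq_integral do rewrite gee0_abs//.
  rewrite (le_lt_trans _ (ltry C))// /g integral_nneseries//; last 2 first.
  - by move=> n; exact/measurable_EFinP.
  - by move=> n x _; rewrite lee_fin.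
  apply: lime_le.
    by apply: is_cvg_nneseries => n _ _; apply: integral_ge0 => x _; rewrite lee_fin.
  apply: nearW => N; rewrite -ge0_integral_sum//; last 2 first.
  - by move=> n; exact/measurable_EFinP.
  - by move=> n x _; rewrite lee_fin.
  by apply: le_trans (fC N); rewrite le_eqVlt; apply/orP; left; apply/eqP;
    apply: eq_integral => x _; rewrite sumEFin.
have := integrable_ae measurableT ig; apply: filterS => w /(_ I) gw.
apply: nondecreasing_is_cvgn.
  by apply: nondecreasing_series => n _ _.
exists (fine (g w)) => _ [N _ <-]; rewrite -lee_fin fineK// -sumEFin.
by apply: nneseries_lim_ge => n _ _; rewrite lee_fin.
Qed.

(** Geometrically decreasing second moments.  With rho < th < 1,
    |M_n| <= th^n + th^-n M_n^2: either |M_n| <= th^n, or |M_n| is at most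
    |M_n| (|M_n| / th^n); and the sum of the th^-n M_n^2 is integrable. *)
Lemma ae_cvg_normed_series (M : nat -> T -> R) (C rho : R) :
  (forall n, measurable_fun setT (M n)) -> 0 < rho < 1 ->
  (forall n, \int[P]_w (M n w ^+ 2)%:E <= (C * rho ^+ n)%:E)%E ->
  {ae P, forall w, cvgn [normed series (fun n => M n w)]}.
Proof.
move=> mM /andP[rho0 rho1] MC.
have C0 : 0 <= C.
  rewrite -[C]mulr1 -(expr0 rho) -lee_fin; apply: le_trans (MC 0%N).
  by apply: integral_ge0 => w _; rewrite lee_fin sqr_ge0.
pose th := (1 + rho) / 2.
have th0 : 0 < th by rewrite /th; lra.
have th1 : th < 1 by rewrite /th; lra.
have rth : 0 <= rho / th < 1.
  by rewrite divr_ge0 ?ltW//= ltr_pdivrMr// mul1r /th; lra.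
pose g n w := th ^- n * M n w ^+ 2.
have mg n : measurable_fun setT (g n).
  by apply: measurable_funM => //; exact: measurable_funX.
have g0 n w : 0 <= g n w by rewrite mulr_ge0 ?sqr_ge0// invr_ge0 exprn_ge0// ltW.
have : {ae P, forall w, cvgn (series (fun n => g n w))}.
  apply: (@ae_cvg_series_ge0 g (C / (1 - rho / th))) => // N.
  under eq_integral do rewrite -sumEFin.
  rewrite ge0_integral_sum//; last 2 first.
  - by move=> n; exact/measurable_EFinP.
  - by move=> n x _; rewrite lee_fin.
  have r1 : 0 < 1 - rho / th by case/andP : rth => _; rewrite subr_gt0.
  apply: (@le_trans _ _ (\sum_(0 <= n < N) C * (rho / th) ^+ n)%:E); last first.
    rewrite lee_fin -mulr_sumr ler_wpM2l// -[leRHS]div1r ler_pdivlMr// big_mkord.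
    rewrite mulrC -opprB mulNr -subrX1 opprB lerBlDr lerDl exprn_ge0//.
    by case/andP : rth.
  rewrite -sumEFin; apply: lee_sum => n _.
  rewrite /g; under eq_integral do rewrite EFinM.
  rewrite ge0_integralZl//; last 3 first.
  - by apply/measurable_EFinP; exact: measurable_funX.
  - by move=> x _; rewrite lee_fin sqr_ge0.
  - by rewrite lee_fin invr_ge0 exprn_ge0// ltW.
  rewrite (_ : C * _ = th ^- n * (C * rho ^+ n)); last first.
    by rewrite [(rho / th) ^+ n]expr_div_n mulrA mulrC.
  rewrite EFinM lee_wpmul2l//.
  by rewrite lee_fin invr_ge0 exprn_ge0// ltW.
apply: filterS => w cg.
apply: (@series_le_cvg _ _ (fun n => th ^+ n + g n w)) => [n|n|n|].
- exact: normr_ge0.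
- by rewrite addr_ge0// exprn_ge0// ltW.
- have tn : 0 < th ^+ n by rewrite exprn_gt0.
  have [|/ltW lt] := leP `|M n w| (th ^+ n); 
    first by move=> h; rewrite (le_trans h)// lerDl.
  rewrite (@le_trans _ _ (g n w))//; last by rewrite lerDr ltW.
  rewrite /g mulrC ler_pdivlMr// -real_normK ?num_real// expr2.
  by rewrite /= ler_wpM2l.
- rewrite (_ : (fun n => _) = (fun n => th ^+ n) + (fun n => g n w))//.
  rewrite seriesD; apply: is_cvgD => //.
  have <- : geometric 1 th = (fun n => th ^+ n).
    by apply/funext => n; rewrite /= mul1r.
  by apply: is_cvg_geometric_series; rewrite ger0_norm// ltW.
Qed.

Lemma cvg_increments (S M : nat -> R) :
  (forall n, S n.+1 - S n = M n) -> cvgn (series M) -> cvgn S.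
Proof.
move=> SM cM; have -> : S = (fun n => S 0%N + series M n).
  apply/funext => n; rewrite /series /= -(eq_bigr _ (fun i _ => SM i)).
  by rewrite telescope_sumr// addrC subrK.
by apply: is_cvgD => //; exact: is_cvg_cst.
Qed.

End almost_sure.

(** * Random polynomials of controlled size *)

Section random_polynomials.
Context {d} {U : measurableType d} {R : realType}.
Variable V : U -> R.
Hypothesis V_ge1 : forall z, 1 <= V z.

(** Random polynomials of degree at most r, whose coefficients are at most of
    order V^r.  The point is stability: the orders add up under
    multiplication, so the degree in x and the order of the moments needed are
    controlled by the same integer. *)
Definition poly_growth (r : nat) (p : U -> {poly R}) : Prop :=
  [/\ forall z, (size (p z) <= r.+1)%N,
      forall i, measurable_fun setT (fun z => (p z)`_i) &
      exists C, forall i z, `|(p z)`_i| <= C * V z ^+ r].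

Let VX_gt0 r z : 0 < V z ^+ r.
Proof. by rewrite exprn_gt0// (lt_le_trans ltr01). Qed.

Lemma poly_growth_le r s p : (r <= s)%N -> poly_growth r p -> poly_growth s p.
Proof.
move=> rs [sp mp [C HC]]; split => //.
  by move=> z; rewrite (leq_trans (sp z)).
exists C => i z; rewrite (le_trans (HC i z))// ler_wpM2l ?ler_weXn2l//.
by rewrite -(pmulr_lge0 _ (VX_gt0 r z)) (le_trans _ (HC i z)).
Qed.

Lemma poly_growthC r (h : U -> R) (C : R) : measurable_fun setT h ->
  (forall z, `|h z| <= C * V z ^+ r) -> poly_growth r (fun z => (h z)%:P).
Proof.
move=> mh hC; split.
- by move=> z; rewrite (leq_trans (size_polyC_leq1 _)).
- move=> [|i]; first by under eq_fun do rewrite coefC eqxx.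
  by under eq_fun do rewrite coefC; exact: measurable_cst.
- exists C => i z; rewrite coefC; case: ifP => // _.
  by rewrite normr0 (le_trans _ (hC z)).
Qed.

Lemma poly_growth_cst (c : R) : poly_growth 0 (fun=> c%:P).
Proof.
by apply: (@poly_growthC 0 (fun=> c) `|c|) => // z; rewrite expr0 mulr1.
Qed.

Lemma poly_growth_var : poly_growth 1 (fun=> 'X).
Proof.
split=> [z|i|]; [by rewrite size_polyX|exact: measurable_cst|].
exists 1 => i z; rewrite mul1r expr1 coefX (le_trans _ (V_ge1 z))//.
by case: (_ == _); rewrite ?normr1// normr0 ler01.
Qed.

Lemma poly_growthD r p q :
  poly_growth r p -> poly_growth r q -> poly_growth r (fun z => p z + q z).
Proof.
move=> [sp mp [C HC]] [sq mq [D HD]]; split.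
- by move=> z; rewrite (leq_trans (size_polyD _ _))// geq_max sp sq.
- by move=> i; under eq_fun do rewrite coefD; exact: measurable_funD.
- exists (C + D) => i z; rewrite coefD mulrDl (le_trans (ler_normD _ _))//.
  exact: lerD.
Qed.

Lemma poly_growthM r s p q : poly_growth r p -> poly_growth s q ->
  poly_growth (r + s) (fun z => p z * q z).
Proof.
move=> [sp mp [C HC]] [sq mq [D HD]].
have szM z : (size (p z * q z)%R <= (r + s).+1)%N.
  rewrite (leq_trans (size_polyMleq _ _))//.
  by rewrite -subn1 leq_subLR add1n -addSn -addnS leq_add.
split => //.
- move=> i; under eq_fun do rewrite coefM.
  by apply: measurable_sum => j; exact: measurable_funM.
- exists ((r + s).+1%:R * (C * D)) => i z.
  have C0 : 0 <= C.
    by rewrite -(pmulr_lge0 _ (VX_gt0 r z)) (le_trans _ (HC 0%N z)).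
  have D0 : 0 <= D.
    by rewrite -(pmulr_lge0 _ (VX_gt0 s z)) (le_trans _ (HD 0%N z)).
  have B0 : 0 <= C * D * V z ^+ (r + s) by rewrite !mulr_ge0// ltW.
  have [irs|irs] := ltnP i (r + s).+1; last first.
    rewrite nth_default ?normr0; last exact: leq_trans (szM z) irs.
    by rewrite -mulrA mulr_ge0.
  rewrite coefM (le_trans (ler_norm_sum _ _ _))//.
  apply: (@le_trans _ _ (\sum_(j < i.+1) C * D * V z ^+ (r + s))).
    apply: ler_sum => j _; rewrite normrM exprD mulrACA.
    exact: ler_pM.
  rewrite sumr_const card_ord -[leLHS]mulr_natl -[leRHS]mulrA ler_wpM2r// ler_nat.
  exact: irs.
Qed.

Lemma poly_growthX r n p : poly_growth r p ->
  poly_growth (r * n) (fun z => p z ^+ n).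
Proof.
move=> pr; elim: n => [|n ih]; first by rewrite muln0; exact: (poly_growth_cst 1).
rewrite mulnS; under eq_fun do rewrite exprS; exact: poly_growthM.
Qed.

Lemma poly_growth_linear (h g : U -> R) :
  measurable_fun setT h -> (forall z, `|h z| <= V z) ->
  measurable_fun setT g -> (forall z, `|g z| <= V z) ->
  poly_growth 1 (fun z => h z *: 'X + (g z)%:P).
Proof.
move=> mh hV mg gV; apply: poly_growthD; last first.
  by apply: (@poly_growthC 1 g 1) => // z; rewrite mul1r.
split=> [z|i|].
- by rewrite (leq_trans (size_scale_leq _ _))// size_polyX.
- under eq_fun do rewrite coefZ coefX.
  by apply: measurable_funM => //; exact: measurable_cst.
- exists 1 => i z; rewrite mul1r expr1 coefZ coefX (le_trans _ (hV z))//.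
  by case: (_ == _); rewrite ?mulr1// mulr0 normr0.
Qed.

Lemma poly_growthZ r (c : R) p : poly_growth r p ->
  poly_growth r (fun z => c *: p z).
Proof.
move=> pr; under eq_fun do rewrite -mul_polyC; rewrite -(add0n r).
by apply: poly_growthM => //; exact: poly_growth_cst.
Qed.

Lemma poly_growth_sum r n (p : 'I_n -> U -> {poly R}) :
  (forall i, poly_growth r (p i)) -> poly_growth r (fun z => \sum_(i < n) p i z).
Proof.
move=> pr; elim: n p pr => [p pr|n ih p pr].
  under eq_fun do rewrite big_ord0.
  by apply: (poly_growth_le (leq0n r)); exact: (poly_growth_cst 0).
under eq_fun do rewrite big_ord_recr/=; apply: poly_growthD => //.
exact: (ih (fun i => p (widen_ord (leqnSn n) i))).
Qed.

End random_polynomials.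

Lemma coef_linear_exp (R : comNzRingType) (b a : R) (n : nat) :
  ((b *: 'X + a%:P) ^+ n)`_n = b ^+ n.
Proof.
have sz k : (size ((b *: 'X + a%:P) ^+ k)%R <= k.+1)%N.
  have s1 : (size (b *: 'X + a%:P : {poly R})%R <= 2)%N.
    rewrite (leq_trans (size_polyD _ _))// geq_max.
    rewrite (leq_trans (size_scale_leq _ _)) ?size_polyX//.
    by rewrite (leq_trans (size_polyC_leq1 _)).
  rewrite (leq_trans (size_poly_exp_leq _ _))// ltnS.
  by rewrite -{2}(mul1n k) leq_mul2r -subn1 leq_subLR addn1 s1 orbT.
elim: n => [|n ih]; first by rewrite !expr0 coefC.
rewrite exprS mulrDl coefD -scalerAl coefZ coefXM/= ih coefCM.
by rewrite [in X in _ + X]nth_default ?mulr0 ?addr0 ?exprS.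
Qed.

(** * Integrals and laws *)

(** Both integrals are integrals over the common law. *)
Lemma same_law_integral {d1 d2 d'} {T1 : measurableType d1}
    {T2 : measurableType d2} {T' : measurableType d'} {R : realType}
    (P1 : probability T1 R) (P2 : probability T2 R)
    (X1 : T1 -> T') (X2 : T2 -> T') (g : T' -> R) :
  measurable_fun setT X1 -> measurable_fun setT X2 ->
  (forall E, measurable E -> P1 (X1 @^-1` E) = P2 (X2 @^-1` E)) ->
  measurable_fun setT g -> P2.-integrable setT (EFin \o (g \o X2)) ->
  P1.-integrable setT (EFin \o (g \o X1)) /\
  \int[P1]_w g (X1 w) = \int[P2]_w g (X2 w).
Proof.
move=> m1 m2 XE mg i2.
pose Y1 : {mfun T1 >-> T'} := HB.pack X1 (isMeasurableFun.Build _ _ _ _ X1 m1).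
pose Y2 : {mfun T2 >-> T'} := HB.pack X2 (isMeasurableFun.Build _ _ _ _ X2 m2).
have LE : forall A, measurable A -> A `<=` setT ->
  distribution P1 Y1 A = distribution P2 Y2 A.
  by move=> A mA _; exact: XE.
have mabs : measurable_fun setT (fun y => `|(g y)%:E|%E).
  by apply/measurable_EFinP; apply: (measurableT_comp (@normr_measurable R _)).
have i1 : P1.-integrable setT (EFin \o (g \o X1)).
  apply/integrableP; split.
    by apply/measurable_EFinP; exact: measurableT_comp.
  have /integrableP[_] := i2.
  have := ge0_integral_distribution (P := P1) Y1 mabs.
  rewrite /comp /= => <-//.
  have := ge0_integral_distribution (P := P2) Y2 mabs.
  by rewrite /comp /= => <-//; rewrite (eq_measure_integral _ LE).
split => //; congr fine.
have := integral_distribution (P := P1) (X := Y1) (f := EFin \o g).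
rewrite /comp /= => <-//; last exact/measurable_EFinP.
have := integral_distribution (P := P2) (X := Y2) (f := EFin \o g).
rewrite /comp /= => <-//; last exact/measurable_EFinP.
exact: eq_measure_integral.
Qed.

Section integrability.
Context {d} {T : measurableType d} {R : realType}.
Variable P : probability T R.

Lemma bounded_integrable (g h : T -> R) : measurable_fun setT g ->
  P.-integrable setT (EFin \o h) -> (forall w, `|g w| <= h w) ->
  P.-integrable setT (EFin \o g).
Proof.
move=> mg ih gh; apply: le_integrable ih => //; first exact/measurable_EFinP.
by move=> w _ /=; rewrite lee_fin (le_trans (gh w))// ler_norm.
Qed.

Lemma Rintegral_probability_cst (c : R) : \int[P]_w c = c.
Proof.
rewrite Rintegral_cst// [X in fine X](_ : _ = 1%E) ?mulr1//.
exact: probability_setT.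
Qed.

Lemma Rintegral_sum (I : eqType) (s : seq I) (h : I -> T -> R) :
  (forall i, i \in s -> P.-integrable setT (EFin \o h i)) ->
  P.-integrable setT (EFin \o (fun w => \sum_(i <- s) h i w)) /\
  \int[P]_w (\sum_(i <- s) h i w) = \sum_(i <- s) \int[P]_w h i w.
Proof.
elim: s => [|j s ih] hi.
  split.
    by under eq_fun do rewrite big_nil; exact: finite_measure_integrable_cst.
  rewrite big_nil; under eq_Rintegral do rewrite big_nil.
  by rewrite Rintegral_probability_cst.
have [i1 e1] := ih (fun i si => hi i (mem_behead (s := j :: s) si)).
have i0 := hi j (mem_head j s).
split.
  have := integrableD measurableT i0 i1.
  by apply: eq_integrable => // w _; rewrite /= big_cons.
rewrite big_cons -e1 -RintegralD//.
by apply: eq_Rintegral => w _; rewrite big_cons.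
Qed.

Lemma integrableZ (c : R) (h : T -> R) : P.-integrable setT (EFin \o h) ->
  P.-integrable setT (EFin \o (fun w => c * h w)).
Proof.
move=> ih; have := integrableZl measurableT c ih.
by apply: eq_integrable => // w _; rewrite /= EFinM.
Qed.

End integrability.

Lemma iid_comp {d d1 d2} {T : measurableType d} {T1 : measurableType d1}
    {T2 : measurableType d2} {R : realType} (P : probability T R)
    (X : nat -> T -> T1) (g : T1 -> T2) :
  measurable_fun setT g -> iid P X -> iid P (fun k w => g (X k w)).
Proof.
move=> mg [iX lX]; have mgE E : measurable E -> measurable (g @^-1` E).
  by move=> mE; rewrite -[_ @^-1` _]setTI; exact: mg.
split=> [s E us s0 mE|k E k0 mE]; last exact: (lX k (g @^-1` E) k0 (mgE _ mE)).
exact: (iX s (fun k => g @^-1` E k) us s0 (fun k ks => mgE _ (mE k ks))).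
Qed.

(** * Moments of affine recursions *)

Definition affine_poly {R : realType} (z : R * R) : {poly R} :=
  z.2 *: 'X + z.1%:P.

Definition pair_weight {R : realType} (z : R * R) : R := 1 + `|z.1| + `|z.2|.

Lemma pair_weight_ge1 {R : realType} (z : R * R) : 1 <= pair_weight z.
Proof. by rewrite /pair_weight -addrA lerDl addr_ge0. Qed.

Lemma poly_growth_affine {R : realType} (j : nat) :
  poly_growth (@pair_weight R) j (fun z => affine_poly z ^+ j).
Proof.
have lin : poly_growth (@pair_weight R) 1 affine_poly.
  apply: poly_growth_linear.
  - exact: measurable_snd.
  - by move=> z; rewrite /pair_weight lerDr addr_ge0.
  - exact: measurable_fst.
  - by move=> z; rewrite /pair_weight addrAC lerDr addr_ge0.
by have := poly_growthX (@pair_weight_ge1 R) j lin; rewrite mul1n.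
Qed.

Lemma horner_affine_poly {R : realType} (z : R * R) (x : R) :
  (affine_poly z).[x] = z.2 * x + z.1.
Proof. by rewrite /affine_poly !hornerE. Qed.

(** The coefficients of (A + B x)^j in x; their means are the c_ji of the
    moment recursion. *)
Lemma affine_polyXE {R : realType} (z : R * R) (j : nat) (x : R) :
  (z.1 + z.2 * x) ^+ j = \sum_(i < j.+1) (affine_poly z ^+ j)`_i * x ^+ i.
Proof.
have [sz _ _] := @poly_growth_affine R j.
rewrite -(horner_coef_wide _ (sz z)) horner_exp; congr (_ ^+ _).
by rewrite horner_affine_poly addrC.
Qed.

Section perpetuity_moments.
Context {d} {T : measurableType d} {R : realType}.
Variables (P : probability T R) (A B : nat -> {mfun T >-> R}).
Hypothesis AB_iid : iid P (fun k w => (A k w, B k w)).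
Variable K : nat.
Hypothesis intK : P.-integrable setT
  (EFin \o (fun w => pair_weight (A 1%N w, B 1%N w) ^+ K)).

Definition affine_moment (j i : nat) : R :=
  \int[P]_w (affine_poly (A 1%N w, B 1%N w) ^+ j)`_i.

(** The perpetuity started after time k and stopped after n terms.  Indexing
    by the starting point gives a recursion at the head of the sum, where the
    first pair is independent of the rest. *)
Fixpoint segment (n k : nat) (w : T) : R :=
  if n is n'.+1 then A k.+1 w + B k.+1 w * segment n' k.+1 w else 0.

(** The value predicted for the j-th moment of [segment n k], for every k. *)
Fixpoint segment_moment (n j : nat) : R :=
  if n is n'.+1 then \sum_(i < j.+1) affine_moment j i * segment_moment n' i
  else (j == 0%N)%:R.

Lemma segmentE n k w : segment n k w =
  \sum_(k <= l < k + n) (\prod_(k <= i < l) B i.+1 w) * A l.+1 w.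
Proof.
elim: n k => [|n ih] k; first by rewrite addn0 big_geq.
rewrite addnS /= big_ltn ?ltnS ?leq_addr// big_geq// mul1r; congr (_ + _).
rewrite ih addSn mulr_sumr; apply: eq_big_nat => l /andP[kl _].
by rewrite [in RHS]big_ltn// mulrA.
Qed.

Lemma perpetuity_partialE n w : perpetuity_partial A B n w = segment n 0 w.
Proof.
rewrite /perpetuity_partial segmentE add0n big_add1/=.
by apply: eq_bigr => l _; rewrite big_add1.
Qed.

Lemma measurable_segmentT n k : measurable_fun setT (segment n k).
Proof.
elim: n k => [|n ih] k /=; first exact: measurable_cst.
apply: measurable_funD; first exact: measurable_funPT.
by apply: measurable_funM; [exact: measurable_funPT|exact: ih].
Qed.

Let Z k w := (A k w, B k w).
Let mZ k : measurable_fun setT (Z k).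
Proof. exact/measurable_fun_pair. Qed.

Lemma affine_moment_int k j i : (0 < k)%N -> (j <= K)%N ->
  P.-integrable setT (EFin \o (fun w => (affine_poly (Z k w) ^+ j)`_i)) /\
  \int[P]_w (affine_poly (Z k w) ^+ j)`_i = affine_moment j i.
Proof.
move=> k0 jK; have [_ mp [C HC]] := @poly_growth_affine R j.
apply: (@same_law_integral _ _ _ _ _ _ _ P P (Z k) (Z 1%N)
  (fun z => (affine_poly z ^+ j)`_i)) => //.
  by move=> E mE; exact: AB_iid.2.
apply: (@bounded_integrable _ _ _ _ _ (fun w => C * pair_weight (Z 1%N w) ^+ K)).
- exact: measurableT_comp (mp i) (mZ 1).
- exact: integrableZ.
- move=> w /=; rewrite (le_trans (HC _ _))// ler_wpM2l//.
    have := le_trans (normr_ge0 _) (HC 0%N (Z 1%N w)).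
    by rewrite pmulr_lge0// exprn_gt0// (lt_le_trans ltr01)// pair_weight_ge1.
  by rewrite ler_weXn2l// pair_weight_ge1.
Qed.

Let Zhead k := events_on Z [set k.+1].
Let Ztail k := events_on Z [set i | (k.+1 < i)%N].

Let mhead k : Zhead k `<=` measurable.
Proof. by apply: measurable_events_on => // i /= ->. Qed.

Let mtail k : Ztail k `<=` measurable.
Proof. by apply: measurable_events_on => // i /= /(leq_trans _); apply. Qed.

Lemma measurable_events_onP (M : set nat) k : M k ->
  measurable_fun setT (Z k : g_sigma_algebraType (events_on Z M) -> _).
Proof.
by move=> Mk _ E mE; apply: sub_sigma_algebra; exists k => //; exists E.
Qed.

Lemma measurable_segment n k : measurable_fun setT
  (segment n k : g_sigma_algebraType (events_on Z [set i | (k < i)%N]) -> R).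
Proof.
have mAB l i : (l < i)%N -> measurable_fun setT
    (A i : g_sigma_algebraType (events_on Z [set i | (l < i)%N]) -> R) /\
    measurable_fun setT
    (B i : g_sigma_algebraType (events_on Z [set i | (l < i)%N]) -> R).
  move=> li; have mZi := @measurable_events_onP [set i | (l < i)%N] i li.
  by split; [exact: measurableT_comp measurable_fst mZi|
             exact: measurableT_comp measurable_snd mZi].
suff H l : (l <= k)%N -> measurable_fun setT
  (segment n k : g_sigma_algebraType (events_on Z [set i | (l < i)%N]) -> R).
  exact: H.
elim: n k => [|n ih] k lk /=; first exact: measurable_cst.
apply: measurable_funD; first exact: (mAB l k.+1 lk).1.
apply: measurable_funM; first exact: (mAB l k.+1 lk).2.
by apply: ih; exact: leqW.
Qed.

(** Induction on n, for all starting points k simultaneously: the pair of index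
    k+1 has the law of the first pair and is independent of the remaining
    segment, so the means of the coefficients factor out. *)
Lemma segment_moment_int n k j : (j <= K)%N ->
  P.-integrable setT (EFin \o (fun w => segment n k w ^+ j)) /\
  \int[P]_w (segment n k w ^+ j) = segment_moment n j.
Proof.
elim: n k j => [|n ih] k j jK /=.
  split; first exact: finite_measure_integrable_cst.
  by rewrite Rintegral_probability_cst expr0n.
pose h (i : 'I_j.+1) w :=
  (affine_poly (Z k.+1 w) ^+ j)`_i * segment n k.+1 w ^+ i.
have hE w : (A k.+1 w + B k.+1 w * segment n k.+1 w) ^+ j = \sum_(i < j.+1) h i w.
  exact: (affine_polyXE (Z k.+1 w)).
have Hh i : P.-integrable setT (EFin \o h i) /\
    \int[P]_w h i w = affine_moment j i * segment_moment n i.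
  have iK : (i <= K)%N by rewrite (leq_trans _ jK)// -ltnS.
  have [i1 e1] := @affine_moment_int k.+1 j i isT jK.
  have [i2 e2] := ih k.+1 i iK.
  rewrite -e1 -e2; apply: (independent_expectationM (@mhead k) (@mtail k)) => //.
  - apply: mutually_independent_disjoint => //; first exact: AB_iid.1.
    + by move=> l /= ->.
    + by move=> l /= /(leq_trans _); apply.
    + by apply/seteqP; split => // l [/= ->]; rewrite ltnn.
  - have [_ mp _] := @poly_growth_affine R j.
    apply: (measurableT_comp (mp i)); exact: measurable_events_onP.
  - by apply: measurable_funX; exact: measurable_segment.
have [iS eS] := Rintegral_sum (s := index_enum 'I_j.+1)
  (fun i _ => (Hh i).1).
split; first by apply: eq_integrable iS => // w _; rewrite /= hE.
under eq_Rintegral do rewrite hE.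
by rewrite eS; apply: eq_bigr => i _; rewrite (Hh i).2.
Qed.

End perpetuity_moments.

(** * The stationary law *)

Definition abs_mfun {d} {T : measurableType d} {R : realType}
    (X : {mfun T >-> R}) : {mfun T >-> R} :=
  HB.pack (fun w => `|X w|) (isMeasurableFun.Build _ _ _ _ (fun w => `|X w|)
    (measurableT_comp (@normr_measurable R setT) (@measurable_funPT _ _ _ _ X))).

Section perpetuity_limit.
Context {d} {T : measurableType d} {R : realType}.
Variables (P : probability T R) (A B : nat -> {mfun T >-> R}).
Hypothesis AB_iid : iid P (fun k w => (A k w, B k w)).
Variable K : nat.
Hypothesis K_gt0 : (0 < K)%N.
Hypothesis intK : P.-integrable setT
  (EFin \o (fun w => pair_weight (A 1%N w, B 1%N w) ^+ K)).
Hypothesis contracting : forall j, (0 < j <= K)%N ->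
  \int[P]_w (`|B 1%N w| ^+ j) < 1.

(* The perpetuity of the absolute values satisfies the same hypotheses; its
   partial sums D dominate those of the original one and are nondecreasing. *)
Let A' k := abs_mfun (A k).
Let B' k := abs_mfun (B k).

Let AB'_iid : iid P (fun k w => (A' k w, B' k w)).
Proof.
have mg : measurable_fun setT (fun z : R * R => (`|z.1|, `|z.2|)).
  apply/measurable_fun_pair => /=.
    exact: (measurableT_comp (@normr_measurable R setT) measurable_fst).
  exact: (measurableT_comp (@normr_measurable R setT) measurable_snd).
exact: (iid_comp mg AB_iid).
Qed.

Let intK' : P.-integrable setT
  (EFin \o (fun w => pair_weight (A' 1%N w, B' 1%N w) ^+ K)).
Proof.
apply: eq_integrable intK => // w _ /=.
by rewrite /pair_weight /= !normr_id.
Qed.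

Let D n w := segment A' B' n 0 w.

Let DE n w : D n w =
  \sum_(0 <= l < n) `|(\prod_(0 <= i < l) B i.+1 w) * A l.+1 w|.
Proof.
rewrite /D segmentE add0n; apply: eq_bigr => l _.
by rewrite normrM normr_prod.
Qed.

Let D_ge0 n w : 0 <= D n w.
Proof. by rewrite DE; apply: sumr_ge0. Qed.

Let D_nd w : {homo D^~ w : n m / (n <= m)%N >-> n <= m}.
Proof.
apply/nondecreasing_seqP => n; rewrite !DE big_nat_recr//= lerDl.
exact: normr_ge0.
Qed.

Let segment_le n w : `|segment A B n 0 w| <= D n w.
Proof. by rewrite segmentE add0n DE; exact: ler_norm_sum. Qed.

(* The diagonal coefficient of the recursion for (|A|, |B|) is E|B|^j. *)
Let D_moment j : (j <= K)%N -> exists M, forall n, \int[P]_w (D n w ^+ j) <= M.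
Proof.
move=> jK.
have [M HM] : exists M, forall n, `|segment_moment P A' B' n j| <= M.
  apply: (@triangular_bounded _ (fun j n => segment_moment P A' B' n j)
    (affine_moment P A' B') K) => // [i|]; last first.
    exists 1 => n; have [_ <-] := segment_moment_int AB'_iid intK' n 0 (leq0n K).
    under eq_Rintegral do rewrite expr0.
    by rewrite Rintegral_probability_cst normr1.
  move=> /contracting; apply: le_lt_trans; rewrite /affine_moment.
  under eq_Rintegral do rewrite coef_linear_exp/=.
  by rewrite ger0_norm// Rintegral_ge0// => w _; rewrite exprn_ge0.
exists M => n; have [_ ->] := segment_moment_int AB'_iid intK' n 0 jK.
exact: le_trans (ler_norm _) (HM n).
Qed.

Let D_int n j : (j <= K)%N -> P.-integrable setT (EFin \o (fun w => D n w ^+ j)).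
Proof. by move=> jK; have [] := segment_moment_int AB'_iid intK' n 0 jK. Qed.

Let mD n j : measurable_fun setT (fun w => (D n w ^+ j)%:E).
Proof.
apply/measurable_EFinP; apply: measurable_funX.
exact: measurable_segmentT.
Qed.

Let D_lintegral n j : (j <= K)%N ->
  (\int[P]_w (D n w ^+ j)%:E)%E = (\int[P]_w (D n w ^+ j))%:E.
Proof. by move=> jK; rewrite fineK//; exact: integrable_fin_num (D_int n jK). Qed.

Let segment_cvg : {ae P, forall w,
  segment A B n 0 w @[n --> \oo] --> perpetuity A B w}.
Proof.
have [M HM] := D_moment K_gt0.
have := @ae_cvg_series_ge0 _ _ _ P
  (fun l w => `|(\prod_(0 <= i < l) B i.+1 w) * A l.+1 w|) M.
have mt l : measurable_fun setT
    (fun w => `|(\prod_(0 <= i < l) B i.+1 w) * A l.+1 w|).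
  apply: (measurableT_comp (@normr_measurable R setT)).
  by apply: measurable_funM => //; apply: measurable_prod.
move=> /(_ mt (fun l w => normr_ge0 _)).
have HN N : (\int[P]_w (\sum_(0 <= n < N)
    `|(\prod_(0 <= i < n) B i.+1 w) * A n.+1 w|)%:E <= M%:E)%E.
  under eq_integral do rewrite -DE -[D _ _]expr1.
  by rewrite D_lintegral// lee_fin.
move=> /(_ HN); apply: filterS => w cw.
have -> : (fun n => segment A B n 0 w) = perpetuity_partial A B ^~ w.
  by apply/funext => n; rewrite perpetuity_partialE.
suff : cvgn (perpetuity_partial A B ^~ w) by [].
have -> : perpetuity_partial A B ^~ w =
    series (fun l => (\prod_(0 <= i < l) B i.+1 w) * A l.+1 w).
  by apply/funext => n; rewrite /series /= perpetuity_partialE segmentE add0n.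
exact: normed_cvg.
Qed.

(** Dominated convergence: the partial sums are bounded in absolute value by D,
    and the limit of D^j is integrable since the moments of D are bounded. *)
Lemma perpetuity_moment j : (j <= K)%N ->
  P.-integrable setT (EFin \o (fun w => perpetuity A B w ^+ j)) /\
  segment_moment P A B n j @[n --> \oo] --> \int[P]_w (perpetuity A B w ^+ j).
Proof.
move=> jK; have [M HM] := D_moment jK.
pose g w := limn (fun n => (D n w ^+ j)%:E).
have ndg w : {homo (fun n => (D n w ^+ j)%:E) : n m / (n <= m)%N >-> (n <= m)%E}.
  by move=> n m nm; rewrite lee_fin lerXn2r ?nnegrE// D_nd.
have cg w : cvgn (fun n => (D n w ^+ j)%:E) by apply: ereal_nondecreasing_is_cvgn.
have Dg n w : ((D n w ^+ j)%:E <= g w)%E.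
  rewrite /g (cvg_lim _ (ereal_nondecreasing_cvgn (ndg w)))//.
  by apply: ereal_sup_ubound; exists n.
have g0 w : (0 <= g w)%E by rewrite (le_trans _ (Dg 0%N w))// lee_fin exprn_ge0.
have mg : measurable_fun setT g.
  by apply: (emeasurable_fun_cvg (fun n w => (D n w ^+ j)%:E)) => // w _; exact: cg.
have ig : P.-integrable setT g.
  apply/integrableP; split => //.
  under eq_integral do rewrite gee0_abs//.
  rewrite (le_lt_trans _ (ltry M))// monotone_convergence//; last first.
    by move=> n w _; rewrite lee_fin exprn_ge0.
  apply: lime_le.
    apply: ereal_nondecreasing_is_cvgn => n m nm.
    by apply: ge0_le_integral => // w _; rewrite ?lee_fin ?exprn_ge0//; exact: ndg.
  by apply: nearW => n; rewrite D_lintegral// lee_fin.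
have ms n : measurable_fun setT (fun w => (segment A B n 0 w ^+ j)%:E).
  apply/measurable_EFinP; apply: measurable_funX.
  exact: measurable_segmentT.
have mp : measurable_fun setT (fun w => (perpetuity A B w ^+ j)%:E).
  by apply/measurable_EFinP; apply: measurable_funX.
have cvgj : {ae P, forall w, setT w ->
    (segment A B n 0 w ^+ j)%:E @[n --> \oo] --> (perpetuity A B w ^+ j)%:E}.
  apply: filterS segment_cvg => w cw _; apply: cvg_EFin; first exact: nearW.
  apply: (cvg_comp _ (fun x : R => x ^+ j) cw); exact: exprn_continuous.
have domj : {ae P, forall w n, setT w -> (`|(segment A B n 0 w ^+ j)%:E| <= g w)%E}.
  apply: aeW => w n _; apply: le_trans (Dg n w).
  by rewrite /= lee_fin normrX lerXn2r ?nnegrE//.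
have [ip _ cp] := dominated_convergence measurableT ms mp cvgj ig domj.
split => //; rewrite /Rintegral.
have -> : (fun n => segment_moment P A B n j) =
    fine \o (fun n => \int[P]_w (segment A B n 0 w ^+ j)%:E)%E.
  by apply/funext => n; have [_ <-] := segment_moment_int AB_iid intK n 0 jK.
apply: fine_cvg; rewrite fineK//; exact: integrable_fin_num.
Qed.

(** Limit of the recursion for the moments of the partial sums. *)
Lemma perpetuity_moment_fixpoint j : (j <= K)%N ->
  \int[P]_w (perpetuity A B w ^+ j) = \sum_(i < j.+1)
    affine_moment P A B j i * \int[P]_w (perpetuity A B w ^+ i).
Proof.
move=> jK; have [_ cj] := perpetuity_moment jK.
have /cvg_lim <-// : segment_moment P A B n.+1 j @[n --> \oo] -->
    \int[P]_w (perpetuity A B w ^+ j).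
  by rewrite (cvg_shiftS (fun n => segment_moment P A B n j)).
apply/cvg_lim => //.
apply: (@cvg_bigsum _ _ _ (fun (i : 'I_j.+1) n =>
  affine_moment P A B j i * segment_moment P A B n i)) => i; apply: cvgMr.
have [] := @perpetuity_moment i => //.
by rewrite (leq_trans _ jK)// -ltnS.
Qed.

End perpetuity_limit.

(** * The observed tree *)

Lemma independent_set0 {d} {T : measurableType d} {R : realType}
    (P : probability T R) (G : set (set T)) :
  G `<=` measurable -> independent P set0 G.
Proof.
move=> mG A B sA sB; apply: (independent_event (F := set0)) => //.
exact: (g_sigma_measurable mG).
Qed.

Lemma measurable_natr_bool {R : realType} :
  measurable_fun setT (fun b : bool => b%:R : R).
Proof. by []. Qed.

Lemma measurable_bool2 (E : set (bool * bool)) : measurable E.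
Proof.
apply: countable_measurable => [[u v]|]; last exact: countableP.
have -> : [set (u, v)] = [set u] `*` [set v].
  by apply/seteqP; split => -[x y] /= [-> ->].
by apply: measurableX.
Qed.

Lemma sum_iota_double {R : nmodType} (F : nat -> R) (u v : nat) :
  \sum_(2 * u <= k < 2 * v) F k =
  \sum_(u <= k < v) (F (2 * k)%N + F (2 * k + 1)%N).
Proof.
have [vu|/subnKC <-] := leqP v u; first by rewrite !big_geq// leq_mul2l vu orbT.
elim: (v - u.+1)%N => [|n ih].
  rewrite addn0 big_nat1 (_ : 2 * u.+1 = (2 * u).+2)%N; last by rewrite mulnS.
  by rewrite big_ltn// big_nat1 addn1.
rewrite addnS (_ : 2 * (u.+1 + n).+1 = (2 * (u.+1 + n)).+2)%N; last first.
  by rewrite mulnS.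
have ule : (u <= u.+1 + n)%N by rewrite ltnW// leq_addr.
have le2 : (2 * u <= 2 * (u.+1 + n))%N by rewrite leq_mul2l ule orbT.
rewrite big_nat_recr/=; last exact: leqW.
by rewrite big_nat_recr//= ih [in RHS]big_nat_recr//= addn1 addrA.
Qed.

Section tree.
Context {R : realType} {disp} {T : measurableType disp}.
Variable P : probability T R.
Variables (a b c d : R) (X eps eta : nat -> {mfun T >-> R}).
Hypothesis XE : forall k w, (0 < k)%N ->
  X (2 * k)%N w = (b + eta (2 * k)%N w) * X k w + a + eps (2 * k)%N w /\
  X (2 * k + 1)%N w =
    (d + eta (2 * k + 1)%N w) * X k w + c + eps (2 * k + 1)%N w.
Variables (p0 p1 p01 : R) (xi0 xi1 : nat -> {mfun T >-> bool}).
Variable delta : nat -> T -> bool.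
Hypothesis delta1 : forall w, delta 1%N w = true.
Hypothesis deltaE : forall k w, (0 < k)%N ->
  delta (2 * k)%N w = delta k w && xi0 k w /\
  delta (2 * k + 1)%N w = delta k w && xi1 k w.
Hypothesis xi_iid : iid P (fun k w => (xi0 k w, xi1 k w)).
Hypothesis xi_law :
  [/\ P [set w | xi0 1%N w = true /\ xi1 1%N w = false] = p0%:E,
      P [set w | xi0 1%N w = false /\ xi1 1%N w = true] = p1%:E,
      P [set w | xi0 1%N w = true /\ xi1 1%N w = true] = p01%:E &
      P [set w | xi0 1%N w = false /\ xi1 1%N w = false]
        = (1 - p0 - p1 - p01)%:E].
Hypothesis noise_iid : iid P (noise eps eta).
Hypothesis noise_X1 : independent P (events_seq (noise eps eta)) (events (X 1%N)).
Hypothesis xi_noise : independent P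
  (events_seq (fun k w => (xi0 k w, xi1 k w)))
  (events_seq (noise eps eta) `|` events (X 1%N)).

Notation fresh := ((R * R * R * R) * (bool * bool))%type.

Let N k : T -> R * R * R * R := noise eps eta k.
Let Xi k : T -> bool * bool := fun w => (xi0 k w, xi1 k w).
Definition draw k (w : T) : fresh := (noise eps eta k w, (xi0 k w, xi1 k w)).

Lemma measurable_noise k : measurable_fun setT (noise eps eta k).
Proof. by rewrite /noise; do 3 apply/measurable_fun_pair => //. Qed.

Let mXi k : measurable_fun setT (Xi k).
Proof. exact/measurable_fun_pair. Qed.

(** * Independence along the tree *)

(** Independence is used in a single form: the draw of k is independent of
    everything generated by X_1 and the draws of the other individuals.  The
    individuals of one generation are handled by the same system, none of them
    being a descendant of another. *)
Definition own_events k : set (set T) :=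
  events_on N [set k] `|` events_on Xi [set k].

Let others k : set nat := [set i | (0 < i)%N /\ i <> k].

Definition other_events k : set (set T) :=
  (events_on N (others k) `|` events (X 1%N)) `|` events_on Xi (others k).

Notation other_type k := (g_sigma_algebraType (other_events k)).

Let mX1 : events (X 1%N) `<=` measurable.
Proof. by move=> _ [E mE <-]; exact: measurable_funPT. Qed.

Let others_gt0 k : others k `<=` [set i | (0 < i)%N].
Proof. by move=> i []. Qed.

Let set1_gt0 k : (0 < k)%N -> [set k] `<=` [set i | (0 < i)%N].
Proof. by move=> k0 i ->. Qed.

Let set1_others k : [set k] `&` others k = set0.
Proof. by apply/seteqP; split => // i [/= -> []]. Qed.

Let mN_on M : M `<=` [set i | (0 < i)%N] -> events_on N M `<=` measurable.
Proof. by move=> M0; apply: measurable_events_on => // k _; exact: measurable_noise. Qed.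

Let mXi_on M : M `<=` [set i | (0 < i)%N] -> events_on Xi M `<=` measurable.
Proof. by move=> M0; apply: measurable_events_on => // k _; exact: mXi. Qed.

Lemma own_events_measurable k : (0 < k)%N -> own_events k `<=` measurable.
Proof.
by move=> k0 A [|]; [apply: mN_on|apply: mXi_on]; exact: set1_gt0.
Qed.

Lemma other_events_measurable k : other_events k `<=` measurable.
Proof. by move=> A [[|]|]; [exact: mN_on|exact: mX1|exact: mXi_on]. Qed.

Let events_on_seq {d'} {T' : measurableType d'} (Y : nat -> T -> T') M :
  M `<=` [set i | (0 < i)%N] -> events_on Y M `<=` events_seq Y.
Proof. by move=> M0 A [i /M0 i0 YA]; exists i. Qed.

(** Regroup twice: the noise of k against the other noises and X_1, then the
    same pair together with the marks, which are independent of both. *)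
Lemma own_other_independent k : (0 < k)%N ->
  independent P (own_events k) (other_events k).
Proof.
move=> k0; have k1 := set1_gt0 k0; have ko := @others_gt0 k.
apply: independent_setU.
- by move=> A [|[|]]; [exact: mN_on|exact: mN_on|exact: mX1].
- by move=> A [|]; exact: mXi_on.
- rewrite -[events_on N [set k]]setU0; apply: independent_setU.
  + by move=> A [|]; exact: mN_on.
  + by move=> A [//|]; exact: mX1.
  + apply: mutually_independent_disjoint => //; last exact: noise_iid.1.
    by move=> i _; exact: measurable_noise.
  + exact: independent_set0.
  + rewrite set0U; apply: independent_sub noise_X1; last exact: sub_sigma_algebra.
    by move=> A [|] h; apply: sub_sigma_algebra; exact: events_on_seq h.
- by apply: mutually_independent_disjoint => //; exact: xi_iid.1.
- apply: independentC; apply: independent_sub xi_noise.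
    by move=> A [|] h; apply: sub_sigma_algebra; exact: events_on_seq h.
  move=> A h; apply: sub_sigma_algebra; case: h => [h|[h|h]].
  + by left; exact: events_on_seq h.
  + by left; exact: events_on_seq h.
  + by right.
Qed.

Lemma draw_own k : measurable_fun setT
  (draw k : g_sigma_algebraType (own_events k) -> fresh).
Proof.
apply/measurable_fun_pair.
- move=> _ E mE; apply: sub_sigma_algebra; left; exists k => //.
  by exists E.
- move=> _ E mE; apply: sub_sigma_algebra; right; exists k => //.
  by exists E.
Qed.

Lemma draw_other k l : (0 < l)%N -> l <> k -> measurable_fun setT
  (draw l : other_type k -> fresh).
Proof.
move=> l0 lk; apply/measurable_fun_pair.
- move=> _ E mE; apply: sub_sigma_algebra; left; left; exists l => //.
  by exists E.
- move=> _ E mE; apply: sub_sigma_algebra; right; exists l => //.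
  by exists E.
Qed.

Let mfst3 : measurable_fun setT (fun z : fresh => z.1.1.1).
Proof.
exact: (measurableT_comp measurable_fst
  (measurableT_comp measurable_fst measurable_fst)).
Qed.

Lemma measurable_eps0 : measurable_fun setT (fun z : fresh => z.1.1.1.1).
Proof. exact: (measurableT_comp measurable_fst mfst3). Qed.

Lemma measurable_eta0 : measurable_fun setT (fun z : fresh => z.1.1.1.2).
Proof. exact: (measurableT_comp measurable_snd mfst3). Qed.

Lemma measurable_eps1 : measurable_fun setT (fun z : fresh => z.1.1.2).
Proof.
exact: (measurableT_comp measurable_snd
  (measurableT_comp measurable_fst measurable_fst)).
Qed.

Lemma measurable_eta1 : measurable_fun setT (fun z : fresh => z.1.2).
Proof. exact: (measurableT_comp measurable_snd measurable_fst). Qed.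

Lemma measurable_kept0 : measurable_fun setT (fun z : fresh => z.2.1%:R : R).
Proof.
apply: (measurableT_comp measurable_natr_bool).
exact: (measurableT_comp measurable_fst measurable_snd).
Qed.

Lemma measurable_kept1 : measurable_fun setT (fun z : fresh => z.2.2%:R : R).
Proof.
apply: (measurableT_comp measurable_natr_bool).
exact: (measurableT_comp measurable_snd measurable_snd).
Qed.

Definition alive k (w : T) : R := (delta k w)%:R.

Lemma alive_double k w : (0 < k)%N ->
  alive (2 * k) w = (draw k w).2.1%:R * alive k w /\
  alive (2 * k + 1) w = (draw k w).2.2%:R * alive k w.
Proof.
move=> /(deltaE w)[e0 e1]; rewrite /alive e0 e1 /=.
by split; rewrite -natrM mulnb andbC.
Qed.

Definition aff0 (z : fresh) : {poly R} :=
  affine_poly (a + z.1.1.1.1, b + z.1.1.1.2).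

Definition aff1 (z : fresh) : {poly R} := affine_poly (c + z.1.1.2, d + z.1.2).

Lemma X_double k w : (0 < k)%N ->
  X (2 * k)%N w = (aff0 (draw k w)).[X k w] /\
  X (2 * k + 1)%N w = (aff1 (draw k w)).[X k w].
Proof.
move=> /(XE w)[-> ->]; rewrite /aff0 /aff1 !horner_affine_poly /=.
by split; rewrite addrA.
Qed.

Lemma tree_ind (Q : nat -> Prop) : Q 1%N ->
  (forall k, (0 < k)%N -> Q k -> Q (2 * k)%N /\ Q (2 * k + 1)%N) ->
  forall k, (0 < k)%N -> Q k.
Proof.
move=> Q1 QS; elim/ltn_ind => -[//|[//|k]] ih _.
have k0 : (0 < k.+2./2)%N by [].
have kh : (k.+2./2 < k.+2)%N by rewrite -divn2 ltn_Pdiv.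
have [q0 q1] := QS k.+2./2 k0 (ih _ kh k0).
rewrite -(odd_double_half k.+2) -mul2n.
by case: (odd _); rewrite ?add0n// add1n -addn1.
Qed.

(** Below 2k no individual descends strictly from k, so that its state does not
    involve the draw of k. *)
Lemma X_alive_other k j : (0 < j)%N -> (j < 2 * k)%N ->
  measurable_fun setT (X j : other_type k -> R) /\
  measurable_fun setT (alive j : other_type k -> R).
Proof.
move: j; apply: tree_ind => [_|j j0 ih].
  split.
    move=> _ E mE; apply: sub_sigma_algebra; left; right; by exists E.
  apply: (eq_measurable_fun (cst 1 : other_type k -> R)) => [w _|];
    last exact: measurable_cst.
  by rewrite /alive delta1.
have aux : (2 * j < 2 * k)%N -> [/\
    measurable_fun setT (X (2 * j)%N : other_type k -> R),
    measurable_fun setT (alive (2 * j) : other_type k -> R),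
    measurable_fun setT (X (2 * j + 1)%N : other_type k -> R) &
    measurable_fun setT (alive (2 * j + 1) : other_type k -> R)].
  rewrite ltn_pmul2l// => jk.
  have [mX ma] := ih (leq_trans jk (leq_pmull k (ltn0Sn 1))).
  have md : measurable_fun setT (draw j : other_type k -> fresh).
    by apply: draw_other => // jE; move: jk; rewrite jE ltnn.
  split.
  - apply: (eq_measurable_fun
      (fun w : other_type k =>
        (b + (draw j w).1.1.1.2) * X j w + a + (draw j w).1.1.1.1)).
      by move=> w _; rewrite (XE w j0).1.
    apply: measurable_funD; last exact: (measurableT_comp measurable_eps0 md).
    apply: measurable_funD; last exact: measurable_cst.
    apply: measurable_funM => //; apply: measurable_funD.
      exact: measurable_cst.
    exact: (measurableT_comp measurable_eta0 md).
  - apply: (eq_measurable_fun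
      (fun w : other_type k => (draw j w).2.1%:R * alive j w)).
      by move=> w _; rewrite (alive_double w j0).1.
    apply: measurable_funM => //; exact: (measurableT_comp measurable_kept0 md).
  - apply: (eq_measurable_fun
      (fun w : other_type k =>
        (d + (draw j w).1.2) * X j w + c + (draw j w).1.1.2)).
      by move=> w _; rewrite (XE w j0).2.
    apply: measurable_funD; last exact: (measurableT_comp measurable_eps1 md).
    apply: measurable_funD; last exact: measurable_cst.
    apply: measurable_funM => //; apply: measurable_funD.
      exact: measurable_cst.
    exact: (measurableT_comp measurable_eta1 md).
  - apply: (eq_measurable_fun
      (fun w : other_type k => (draw j w).2.2%:R * alive j w)).
      by move=> w _; rewrite (alive_double w j0).2.
    apply: measurable_funM => //; exact: (measurableT_comp measurable_kept1 md).
split=> jk; first by have [] := aux jk.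
by have [] := aux (leq_ltn_trans (leq_addr _ _) jk).
Qed.

(** * Moments of one draw *)

(** The weight is the same for both children, so that mixed monomials in the
    two children stay in the class. *)
Definition weight (z : fresh) : R := 1 + `|a + z.1.1.1.1| + `|b + z.1.1.1.2|
  + `|c + z.1.1.2| + `|d + z.1.2|.

Lemma weight_ge1 z : 1 <= weight z.
Proof. by rewrite /weight -!addrA lerDl ?addr_ge0//. Qed.

Lemma poly_growth_aff0 : poly_growth weight 1 aff0.
Proof.
apply: poly_growth_linear.
- by apply: measurable_funD; [exact: measurable_cst|exact: measurable_eta0].
- by move=> z; rewrite /weight [_ + `|b + _|]addrC -!addrA lerDl ?addr_ge0//.
- by apply: measurable_funD; [exact: measurable_cst|exact: measurable_eps0].
- by move=> z; rewrite /weight [1 + _]addrC -!addrA lerDl ?addr_ge0//.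
Qed.

Lemma poly_growth_aff1 : poly_growth weight 1 aff1.
Proof.
apply: poly_growth_linear.
- by apply: measurable_funD; [exact: measurable_cst|exact: measurable_eta1].
- by move=> z; rewrite /weight [leRHS]addrC lerDl ?addr_ge0//.
- by apply: measurable_funD; [exact: measurable_cst|exact: measurable_eps1].
- by move=> z; rewrite /weight [_ + `|c + _|]addrC -!addrA lerDl ?addr_ge0//.
Qed.

Let kept_le1 (u : bool) z : `|u%:R : R| <= 1 * weight z ^+ 0.
Proof. by rewrite expr0 mulr1; case: u; rewrite ?normr1// normr0. Qed.

Lemma poly_growth_child0 r p : poly_growth weight r p ->
  poly_growth weight r (fun z => (z.2.1%:R)%:P * p z).
Proof.
rewrite -{2}(add0n r) => pr; apply: poly_growthM => //; first exact: weight_ge1.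
apply: (@poly_growthC _ _ _ weight 0 (fun z => z.2.1%:R) 1) => [|z].
  exact: measurable_kept0.
exact: kept_le1.
Qed.

Lemma poly_growth_child1 r p : poly_growth weight r p ->
  poly_growth weight r (fun z => (z.2.2%:R)%:P * p z).
Proof.
rewrite -{2}(add0n r) => pr; apply: poly_growthM => //; first exact: weight_ge1.
apply: (@poly_growthC _ _ _ weight 0 (fun z => z.2.2%:R) 1) => [|z].
  exact: measurable_kept1.
exact: kept_le1.
Qed.

Lemma poly_growth_aff0X j : poly_growth weight j (fun z => aff0 z ^+ j).
Proof. by have := poly_growthX weight_ge1 j poly_growth_aff0; rewrite mul1n. Qed.

Lemma poly_growth_aff1X j : poly_growth weight j (fun z => aff1 z ^+ j).
Proof. by have := poly_growthX weight_ge1 j poly_growth_aff1; rewrite mul1n. Qed.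

(** Evaluated at X_k, this is the sum of the j-th powers of the values of the
    observed children of k, for k itself observed. *)
Definition offspring j (z : fresh) : {poly R} :=
  (z.2.1%:R)%:P * aff0 z ^+ j + (z.2.2%:R)%:P * aff1 z ^+ j.

Lemma poly_growth_offspring j : poly_growth weight j (offspring j).
Proof.
by apply: poly_growthD; [apply: poly_growth_child0; exact: poly_growth_aff0X|
  apply: poly_growth_child1; exact: poly_growth_aff1X].
Qed.

Definition kept_values : seq (bool * bool) :=
  [:: (true, true); (true, false); (false, true); (false, false)].

Definition kept_prob (u : bool * bool) : R :=
  if u.1 then (if u.2 then p01 else p0)
  else (if u.2 then p1 else 1 - p0 - p1 - p01).

(** The expectation of h under the law of one draw, with the marks integrated
    out: this is the form taken by the kernel P. *)
Definition draw_mean (h : fresh -> R) : R :=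
  \sum_(u <- kept_values) kept_prob u * \int[P]_w h (noise eps eta 1 w, u).

Lemma kept_probE k u : (0 < k)%N -> P (Xi k @^-1` [set u]) = (kept_prob u)%:E.
Proof.
move=> k0; rewrite xi_iid.2//; last exact: measurable_bool2.
have [e0 e1 e01 e00] := xi_law.
case: u => -[] []; rewrite /kept_prob /= -?e0 -?e1 -?e01 -?e00; congr (P _);
  by apply/seteqP; split => w /=; rewrite /Xi => -[-> ->].
Qed.

Variable Q : nat.
Hypothesis weight_int : P.-integrable setT
  (EFin \o (fun w => weight (draw 1 w) ^+ Q)).

Lemma growth_int1 (h : fresh -> R) (C : R) r u : (r <= Q)%N ->
  measurable_fun setT h -> (forall z, `|h z| <= C * weight z ^+ r) ->
  P.-integrable setT (EFin \o (fun w => h (noise eps eta 1 w, u))).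
Proof.
move=> rQ mh hC.
apply: (@bounded_integrable _ _ _ _ _ (fun w => C * weight (draw 1 w) ^+ Q)).
- exact: (measurableT_comp (measurable_fun_pair1 u mh) (measurable_noise 1)).
- exact: integrableZ.
- move=> w; rewrite (le_trans (hC _))// ler_wpM2l//.
    have := le_trans (normr_ge0 _) (hC (draw 1 w)).
    by rewrite pmulr_lge0// exprn_gt0// (lt_le_trans ltr01)// weight_ge1.
  by rewrite ler_weXn2l// weight_ge1.
Qed.

(** Condition on the four values of the marks, which are independent of the
    noise. *)
Lemma draw_expectation k (h : fresh -> R) (C : R) r : (0 < k)%N -> (r <= Q)%N ->
  measurable_fun setT h -> (forall z, `|h z| <= C * weight z ^+ r) ->
  P.-integrable setT (EFin \o (fun w => h (draw k w))) /\
  \int[P]_w h (draw k w) = draw_mean h.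
Proof.
move=> k0 rQ mh hC.
pose g u w : R := (Xi k w == u)%:R * h (noise eps eta k w, u).
have hE w : h (draw k w) = \sum_(u <- kept_values) g u w.
  rewrite /g /kept_values !big_cons big_nil /draw /Xi.
  by case: (xi0 k w); case: (xi1 k w); rewrite /= ?mul0r ?mul1r ?add0r ?addr0.
have indic u : (fun w => (Xi k w == u)%:R : R) = \1_(Xi k @^-1` [set u]).
  apply/funext => w; rewrite indicE; congr (_%:R); congr (nat_of_bool _).
  by apply/eqP/idP; rewrite inE.
have mu u : measurable (Xi k @^-1` [set u]).
  by rewrite -[_ @^-1` _]setTI; apply: mXi => //; exact: measurable_bool2.
have gi u : P.-integrable setT (EFin \o g u) /\
    \int[P]_w g u w = kept_prob u * \int[P]_w h (noise eps eta 1 w, u).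
  have [i1 e1] := same_law_integral (P1 := P) (P2 := P) (measurable_noise k)
    (measurable_noise 1) (fun E mE => noise_iid.2 k E k0 mE)
    (measurable_fun_pair1 u mh) (growth_int1 u rQ mh hC).
  have i0 : P.-integrable setT (EFin \o (fun w => (Xi k w == u)%:R : R)).
    by rewrite indic; exact: integrable_indic.
  have e0 : \int[P]_w ((Xi k w == u)%:R : R) = kept_prob u.
    rewrite indic /Rintegral integral_indic// setIT.
    by rewrite -[RHS]/(fine (kept_prob u)%:E); congr fine; exact: kept_probE.
  rewrite -e0 -e1.
  apply: (independent_expectationM (F := events_on Xi [set k])
    (G := events_on N [set k])) => //.
  - by apply: mXi_on; exact: set1_gt0.
  - by apply: mN_on; exact: set1_gt0.
  - apply: independent_sub xi_noise => A h0; apply: sub_sigma_algebra.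
      by apply: events_on_seq h0; exact: set1_gt0.
    by left; apply: events_on_seq h0; exact: set1_gt0.
  - move=> _ E mE; rewrite setTI; apply: sub_sigma_algebra; exists k => //.
    exists ((fun v => (v == u)%:R) @^-1` E) => //; last by rewrite setTI.
    exact: measurable_bool2.
  - apply: (measurableT_comp (measurable_fun_pair1 u mh)).
    by move=> _ E mE; apply: sub_sigma_algebra; exists k => //; exists E.
have [iS eS] := Rintegral_sum (s := kept_values) (fun u _ => (gi u).1).
split; first by apply: eq_integrable iS => // w _; rewrite /= hE.
under eq_Rintegral do rewrite hE.
by rewrite eS; apply: eq_bigr => u _; rewrite (gi u).2.
Qed.

Hypothesis X1_int : forall i, (i <= Q)%N ->
  P.-integrable setT (EFin \o (fun w => X 1%N w ^+ i)).

Lemma independent_drawM k (U : T -> R) (h : fresh -> R) (C : R) r :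
  (0 < k)%N -> (r <= Q)%N ->
  measurable_fun setT (U : other_type k -> R) ->
  P.-integrable setT (EFin \o U) ->
  measurable_fun setT h -> (forall z, `|h z| <= C * weight z ^+ r) ->
  P.-integrable setT (EFin \o (fun w => h (draw k w) * U w)) /\
  \int[P]_w (h (draw k w) * U w) = draw_mean h * \int[P]_w U w.
Proof.
move=> k0 rQ mU iU mh hC; have [ih <-] := draw_expectation k0 rQ mh hC.
apply: (independent_expectationM (own_events_measurable k0)
  (@other_events_measurable k)) => //.
  exact: own_other_independent.
apply: (measurableT_comp mh); exact: draw_own.
Qed.

Lemma alive_other k j : (0 < j)%N -> (j < 2 * k)%N -> forall i,
  measurable_fun setT
    ((fun w => alive j w * X j w ^+ i) : other_type k -> R).
Proof.
move=> j0 jk i; have [mX ma] := X_alive_other j0 jk.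
by apply: measurable_funM => //; exact: measurable_funX.
Qed.

Let ltn_double k : (0 < k)%N -> (k < 2 * k)%N.
Proof. by move=> k0; rewrite ltn_Pmull. Qed.

(** The step from an individual to its children: the coefficients of p (Z_k)
    are independent of the state of k. *)
Lemma alive_poly_expectation k j p : (0 < k)%N -> (j <= Q)%N ->
  poly_growth weight j p ->
  (forall i, (i <= Q)%N ->
     P.-integrable setT (EFin \o (fun w => alive k w * X k w ^+ i))) ->
  P.-integrable setT (EFin \o (fun w => alive k w * (p (draw k w)).[X k w])) /\
  \int[P]_w (alive k w * (p (draw k w)).[X k w]) =
  \sum_(i < j.+1) draw_mean (fun z => (p z)`_i) * \int[P]_w (alive k w * X k w ^+ i).
Proof.
move=> k0 jQ [sp mp [C HC]] iX.
pose g (i : 'I_j.+1) w := (p (draw k w))`_i * (alive k w * X k w ^+ i).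
have gE w : alive k w * (p (draw k w)).[X k w] = \sum_(i < j.+1) g i w.
  rewrite (horner_coef_wide _ (sp _)) mulr_sumr.
  by apply: eq_bigr => i _; rewrite mulrCA.
have Hg i : P.-integrable setT (EFin \o g i) /\
    \int[P]_w g i w =
    draw_mean (fun z => (p z)`_i) * \int[P]_w (alive k w * X k w ^+ i).
  apply: (independent_drawM k0 jQ (alive_other k0 (ltn_double k0) i) _ (mp i)).
    by apply: iX; rewrite (leq_trans _ jQ)// -ltnS.
  by move=> z; exact: HC.
have [iS eS] := Rintegral_sum (s := index_enum 'I_j.+1) (fun i _ => (Hg i).1).
split; first by apply: eq_integrable iS => // w _; rewrite /= gE.
under eq_Rintegral do rewrite gE.
by rewrite eS; apply: eq_bigr => i _; rewrite (Hg i).2.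
Qed.

Let child0E k j w : (0 < k)%N -> alive (2 * k) w * X (2 * k)%N w ^+ j =
  alive k w * ((draw k w).2.1%:R%:P * aff0 (draw k w) ^+ j).[X k w].
Proof.
move=> k0; rewrite (X_double w k0).1 (alive_double w k0).1.
by rewrite hornerM hornerC horner_exp mulrCA mulrA.
Qed.

Let child1E k j w : (0 < k)%N -> alive (2 * k + 1) w * X (2 * k + 1)%N w ^+ j =
  alive k w * ((draw k w).2.2%:R%:P * aff1 (draw k w) ^+ j).[X k w].
Proof.
move=> k0; rewrite (X_double w k0).2 (alive_double w k0).2.
by rewrite hornerM hornerC horner_exp mulrCA mulrA.
Qed.

Lemma alive_moment_int k : (0 < k)%N -> forall i, (i <= Q)%N ->
  P.-integrable setT (EFin \o (fun w => alive k w * X k w ^+ i)).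
Proof.
move: k; apply: tree_ind => [i iQ|k k0 ih].
  by apply: eq_integrable (X1_int iQ) => // w _; rewrite /= /alive delta1 mul1r.
split=> i iQ.
- have [iX _] := alive_poly_expectation k0 iQ
    (poly_growth_child0 (poly_growth_aff0X i)) ih.
  by apply: eq_integrable iX => // w _; rewrite /= child0E.
- have [iX _] := alive_poly_expectation k0 iQ
    (poly_growth_child1 (poly_growth_aff1X i)) ih.
  by apply: eq_integrable iX => // w _; rewrite /= child1E.
Qed.

(** * Mean power sums *)

Variable m : R.
Hypothesis mE : m = 2 * p01 + p0 + p1.
Hypothesis m_gt1 : 1 < m.

Definition generation n := index_iota (2 ^ n) (2 ^ n.+1).

Lemma generation_gt0 n k : k \in generation n -> (0 < k)%N.
Proof. by rewrite mem_index_iota => /andP[+ _]; apply: leq_trans; rewrite expn_gt0. Qed.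

Lemma generationS (F : nat -> R) n : \sum_(k <- generation n.+1) F k =
  \sum_(k <- generation n) (F (2 * k)%N + F (2 * k + 1)%N).
Proof. by rewrite /generation [in LHS]expnS [in LHS](expnS _ n.+1) sum_iota_double. Qed.

Definition power_mean j n w : R :=
  m ^- n * \sum_(k <- generation n) alive k w * X k w ^+ j.

Definition offspring_moment j i : R := draw_mean (fun z => (offspring j z)`_i) / m.

Lemma power_meanS j n w : power_mean j n.+1 w =
  m ^- n.+1 * \sum_(k <- generation n) alive k w * (offspring j (draw k w)).[X k w].
Proof.
rewrite /power_mean; congr (_ * _); rewrite generationS.
apply: eq_big_seq => k /generation_gt0 k0.
by rewrite child0E// child1E// -mulrDr -hornerD.
Qed.

Let m_neq0 : m != 0.
Proof. by rewrite gt_eqF// (lt_trans ltr01). Qed.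

Lemma power_mean_int j n : (j <= Q)%N ->
  P.-integrable setT (EFin \o power_mean j n) /\
  \int[P]_w power_mean j n w =
  m ^- n * \sum_(k <- generation n) \int[P]_w (alive k w * X k w ^+ j).
Proof.
move=> jQ; have [iS eS] := Rintegral_sum (s := generation n)
  (fun k kn => alive_moment_int (generation_gt0 kn) jQ).
by split; [exact: integrableZ|rewrite RintegralZl// eS].
Qed.

(** The mean number of observed children per observed individual being m, the
    normalisation m^-n turns the moment recursion into a linear one whose
    coefficient of index (0, 0) is 1. *)
Lemma power_mean_rec j n : (j <= Q)%N -> \int[P]_w power_mean j n.+1 w =
  \sum_(i < j.+1) offspring_moment j i * \int[P]_w power_mean i n w.
Proof.
move=> jQ; under eq_Rintegral do rewrite power_meanS.
have H k : k \in generation n -> _ := fun kn => alive_poly_expectation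
  (generation_gt0 kn) jQ (poly_growth_offspring j)
  (alive_moment_int (generation_gt0 kn)).
have [iS eS] := Rintegral_sum (s := generation n) (fun k kn => (H k kn).1).
rewrite RintegralZl// eS (eq_big_seq _ (fun k kn => (H k kn).2)).
rewrite exchange_big mulr_sumr; apply: eq_bigr => i _ /=.
have iQ : (i <= Q)%N by rewrite (leq_trans _ jQ)// -ltnS.
have [_ ->] := power_mean_int n iQ.
rewrite -mulr_sumr /offspring_moment exprS invfM !mulrA; congr (_ * _).
by rewrite mulrAC [m^-1 * _]mulrC -!mulrA; congr (_ * _); rewrite mulrC.
Qed.

Lemma draw_mean_kept (f : bool * bool -> R) : draw_mean (fun z => f z.2) =
  p01 * f (true, true) + p0 * f (true, false) + p1 * f (false, true)
  + (1 - p0 - p1 - p01) * f (false, false).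
Proof.
rewrite /draw_mean /kept_values !big_cons big_nil /kept_prob /=.
by rewrite !Rintegral_probability_cst addr0 !addrA.
Qed.

Lemma offspring_moment00 : offspring_moment 0 0 = 1.
Proof.
rewrite /offspring_moment (_ : (fun z => _) =
  (fun z : fresh => (fun u : bool * bool => u.1%:R + u.2%:R : R) z.2)).
  rewrite (draw_mean_kept (fun u => u.1%:R + u.2%:R)) /=.
  by rewrite [X in X / _](_ : _ = m) ?divff// mE; ring.
by apply/funext => z; rewrite /offspring !expr0 !mulr1 -polyCD coefC.
Qed.

Hypothesis offspring_contracting : forall j, (0 < j <= Q)%N ->
  `|offspring_moment j j| < 1.

Lemma power_mean_bounded j : (j <= Q)%N ->
  exists M, forall n, `|\int[P]_w power_mean j n w| <= M.
Proof.
move: j; apply: (@triangular_bounded _ (fun j n => \int[P]_w power_mean j n w)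
  offspring_moment Q) => // [j n jQ|]; first exact: power_mean_rec.
exists `|\int[P]_w power_mean 0 0 w|.
elim=> [//|n]; apply: le_trans.
by rewrite power_mean_rec// big_ord_recl big_ord0 addr0 offspring_moment00 mul1r.
Qed.

(** * Fluctuations and almost sure limits *)

Variable q : nat.
Hypothesis qQ : (q * 2 <= Q)%N.

(** The error made when h (Z_k) is replaced by its mean. *)
Definition fluctuation (h : fresh -> R) i n w : R :=
  m ^- n * \sum_(k <- generation n)
    alive k w * X k w ^+ i * (h (draw k w) - draw_mean h).

Let q_le_Q : (q <= Q)%N.
Proof. by rewrite (leq_trans _ qQ)// leq_pmulr. Qed.

Let m_gt0 : 0 < m.
Proof. exact: lt_trans ltr01 m_gt1. Qed.

Section fluctuation_bound.
Variables (h : fresh -> R) (C : R).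
Hypothesis mh : measurable_fun setT h.
Hypothesis hC : forall z, `|h z| <= C * weight z ^+ q.

Let g z := h z - draw_mean h.

Let mg : measurable_fun setT g.
Proof. by apply: measurable_funB => //; exact: measurable_cst. Qed.

Let gC z : `|g z| <= (C + `|draw_mean h|) * weight z ^+ q.
Proof.
rewrite mulrDl (le_trans (ler_normB _ _))// lerD// ler_peMr//.
by rewrite exprn_ege1// weight_ge1.
Qed.

Let g2C z : `|g z ^+ 2| <= (C + `|draw_mean h|) ^+ 2 * weight z ^+ (q * 2).
Proof. by rewrite normrX exprM -exprMn lerXn2r ?nnegrE// (le_trans _ (gC z)). Qed.

Let mg2 : measurable_fun setT (fun z => g z ^+ 2).
Proof. exact: measurable_funX. Qed.

Lemma draw_mean_centered : draw_mean g = 0.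
Proof.
have [ig <-] := draw_expectation (isT : (0 < 1)%N) q_le_Q mg gC.
have [ih eh] := draw_expectation (isT : (0 < 1)%N) q_le_Q mh hC.
rewrite RintegralB//; last exact: finite_measure_integrable_cst.
by rewrite eh Rintegral_probability_cst subrr.
Qed.

Variable i : nat.
Hypothesis iq : (i <= q)%N.

Let iQ : (i * 2 <= Q)%N.
Proof. by rewrite (leq_trans _ qQ)// leq_mul2r iq. Qed.

Let D k w := alive k w * X k w ^+ i * g (draw k w).

Let aliveK k w : alive k w * alive k w = alive k w.
Proof. by rewrite /alive; case: delta; rewrite ?mulr1// mulr0. Qed.

Let D2E k w : D k w * D k w =
  g (draw k w) ^+ 2 * (alive k w * X k w ^+ (i * 2)).
Proof. by rewrite /D exprM -[in RHS]aliveK !expr2; ring. Qed.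

Let D2_int k : (0 < k)%N ->
  P.-integrable setT (EFin \o (fun w => D k w * D k w)) /\
  \int[P]_w (D k w * D k w) =
  draw_mean (fun z => g z ^+ 2) * \int[P]_w (alive k w * X k w ^+ (i * 2)).
Proof.
move=> k0; have [i2 e2] := independent_drawM k0 qQ
  (alive_other k0 (ltn_double k0) (i * 2)) (alive_moment_int k0 iQ) mg2 g2C.
split; first by apply: eq_integrable i2 => // w _; rewrite /= D2E.
by rewrite -e2; apply: eq_Rintegral => w _; exact: D2E.
Qed.

(* Orthogonality: everything except the centred factor g (Z_k) is a function of
   the draws other than that of k.  The product of the other factors is
   integrable, being at most the sum of two squares. *)
Let DD_int k l : (0 < k)%N -> (0 < l)%N -> (l < 2 * k)%N -> l <> k ->
  P.-integrable setT (EFin \o (fun w => D k w * D l w)) /\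
  \int[P]_w (D k w * D l w) = 0.
Proof.
move=> k0 l0 lk lNk.
pose U w := (alive k w * X k w ^+ i) * D l w.
have DE w : D k w * D l w = g (draw k w) * U w.
  by rewrite /U /D; ring.
have mUp : measurable_fun setT (U : other_type k -> R).
  apply: measurable_funM; first exact: alive_other k0 (ltn_double k0) i.
  apply: measurable_funM; first exact: alive_other l0 lk i.
  apply: (measurableT_comp mg); exact: draw_other.
have iU : P.-integrable setT (EFin \o U).
  have mU : measurable_fun setT U.
    by move=> _ B mB; apply: (g_sigma_measurable (@other_events_measurable k));
      exact: mUp.
  apply: (@bounded_integrable _ _ _ P U
    (fun w => alive k w * X k w ^+ (i * 2) + D l w * D l w)) => //.
    have := integrableD measurableT (alive_moment_int k0 iQ) (D2_int l0).1.
    by apply: eq_integrable.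
  move=> w; rewrite /U exprM -[X in X * _ + _]aliveK.
  set x := alive k w * X k w ^+ i; set y := D l w.
  rewrite (_ : alive k w * alive k w * _ = x ^+ 2); last first.
    by rewrite /x exprMn expr2.
  rewrite -expr2 ler_norml; nra.
have [i1 e1] := independent_drawM k0 q_le_Q mUp iU mg gC.
split; first by apply: eq_integrable i1 => // w _; rewrite /= DE.
by under eq_Rintegral do rewrite DE; rewrite e1 draw_mean_centered mul0r.
Qed.

Let DD k l n : k \in generation n -> l \in generation n ->
  P.-integrable setT (EFin \o (fun w => D k w * D l w)) /\
  \int[P]_w (D k w * D l w) = if l == k then \int[P]_w (D k w * D k w) else 0.
Proof.
move=> kn ln; have k0 := generation_gt0 kn; have l0 := generation_gt0 ln.
have [->|/eqP lk] := eqVneq l k; first by have [] := D2_int k0.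
apply: DD_int => //; move: kn ln; rewrite !mem_index_iota => /andP[nk _] /andP[_].
by move=> /leq_trans; apply; rewrite expnS leq_mul2l nk.
Qed.

(** Only the diagonal terms of the double sum survive. *)
Lemma fluctuation_variance n :
  P.-integrable setT (EFin \o (fun w => fluctuation h i n w ^+ 2)) /\
  \int[P]_w (fluctuation h i n w ^+ 2) =
  m ^- n * (draw_mean (fun z => g z ^+ 2) * \int[P]_w power_mean (i * 2) n w).
Proof.
have FE w : fluctuation h i n w ^+ 2 = (m ^- n * m ^- n) *
    \sum_(k <- generation n) \sum_(l <- generation n) D k w * D l w.
  by rewrite /fluctuation exprMn -expr2; congr (_ * _); rewrite expr2 big_distrlr.
have Hk k : k \in generation n -> P.-integrable setT
    (EFin \o (fun w => \sum_(l <- generation n) D k w * D l w)) /\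
    \int[P]_w (\sum_(l <- generation n) D k w * D l w) =
    draw_mean (fun z => g z ^+ 2) * \int[P]_w (alive k w * X k w ^+ (i * 2)).
  move=> kn.
  have [iS eS] := Rintegral_sum (s := generation n) (fun l ln => (DD kn ln).1).
  split=> //; rewrite eS (eq_big_seq _ (fun l ln => (DD kn ln).2)).
  rewrite (bigD1_seq k kn (iota_uniq _ _))/= eqxx big1 ?addr0 => [|l /negPf ->//].
  by have [_ ->] := D2_int (generation_gt0 kn).
have [iS eS] := Rintegral_sum (s := generation n) (fun k kn => (Hk k kn).1).
split.
  by apply: eq_integrable (integrableZ (m ^- n * m ^- n) iS) => // w _; rewrite /= FE.
under eq_Rintegral do rewrite FE.
rewrite RintegralZl// eS (eq_big_seq _ (fun k kn => (Hk k kn).2)) -mulr_sumr.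
by have [_ ->] := power_mean_int n iQ; rewrite -mulrA; congr (_ * _); ring.
Qed.

(** The variance decreases like m^-n because E[S_2i(n)] is bounded, and
    m > 1 makes this summable. *)
Lemma fluctuation_summable :
  {ae P, forall w, cvgn [normed series (fun n => fluctuation h i n w)]}.
Proof.
have [B HB] := power_mean_bounded iQ.
have B0 : 0 <= B := le_trans (normr_ge0 _) (HB 0%N).
apply: (@ae_cvg_normed_series _ _ _ P (fun n w => fluctuation h i n w)
  (`|draw_mean (fun z => g z ^+ 2)| * B) m^-1).
- move=> n; have iD k : k \in generation n -> P.-integrable setT (EFin \o D k).
    move=> /generation_gt0 k0; have [iD _] := independent_drawM k0 q_le_Q
      (alive_other k0 (ltn_double k0) i)
      (alive_moment_int k0 (leq_trans iq q_le_Q)) mg gC.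
    by apply: eq_integrable iD => // w _; rewrite /= mulrC.
  have [iS _] := Rintegral_sum iD.
  by have /measurable_int/measurable_EFinP := integrableZ (m ^- n) iS.
- by rewrite invr_gt0 m_gt0 invf_lt1.
- move=> n; have [i2 e2] := fluctuation_variance n.
  have -> : (\int[P]_w (fluctuation h i n w ^+ 2)%:E)%E =
      (\int[P]_w (fluctuation h i n w ^+ 2))%:E.
    by rewrite fineK//; exact: integrable_fin_num i2.
  have mn0 : 0 <= m ^- n by rewrite invr_ge0 exprn_ge0// ltW.
  rewrite lee_fin e2 exprVn mulrC; apply: ler_wpM2r => //.
  rewrite (le_trans (ler_norm _))// normrM; apply: ler_wpM2l => //.
Qed.

End fluctuation_bound.

Lemma generation_poly_sum r p n w : poly_growth weight r p ->
  m ^- n * \sum_(k <- generation n) alive k w * (p (draw k w)).[X k w] =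
  \sum_(i < r.+1) (fluctuation (fun z => (p z)`_i) i n w
                   + draw_mean (fun z => (p z)`_i) * power_mean i n w).
Proof.
move=> [sp _ _]; under eq_bigr do rewrite (horner_coef_wide _ (sp _)) mulr_sumr.
rewrite exchange_big mulr_sumr; apply: eq_bigr => i _ /=.
rewrite /fluctuation /power_mean mulrCA -mulrDr; congr (_ * _).
rewrite mulr_sumr -big_split; apply: eq_bigr => k _ /=; ring.
Qed.

Lemma power_mean0E n w :
  power_mean 0 n w = (size (observed delta n w))%:R / m ^+ n.
Proof.
rewrite /power_mean mulrC; congr (_ / _).
rewrite /observed size_filter -sum1_count natr_sum [RHS]big_mkcond /=.
by apply: eq_bigr => k _; rewrite expr0 mulr1 /alive; case: delta.
Qed.

Let offspring_coef_summable j i : (i <= j)%N -> (j <= q)%N ->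
  {ae P, forall w, cvgn [normed series
    (fun n => fluctuation (fun z => (offspring j z)`_i) i n w)]}.
Proof.
move=> ij jq.
have [_ mp [C HC]] := poly_growth_le weight_ge1 jq (poly_growth_offspring j).
by apply: (@fluctuation_summable _ C) => //; exact: leq_trans ij jq.
Qed.

(** For each point of the almost sure event on which all the fluctuations are
    summable, S_j - l_j W satisfies a deterministic triangular recursion. *)
Lemma power_mean_cvg (l : nat -> R) : l 0%N = 1 ->
  (forall j, (j <= q)%N -> l j = \sum_(i < j.+1) offspring_moment j i * l i) ->
  {ae P, forall w j, (j <= q)%N ->
    power_mean j n w @[n --> \oo] --> l j * population_limit delta m w}.
Proof.
move=> l0 lE.
have : {ae P, forall w j i, (i <= j)%N -> (j <= q)%N -> cvgn [normed series
    (fun n => fluctuation (fun z => (offspring j z)`_i) i n w)]}.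
  apply: (ae_foralln (P := fun j w => forall i, (i <= j)%N -> (j <= q)%N ->
    cvgn [normed series
      (fun n => fluctuation (fun z => (offspring j z)`_i) i n w)])) => j.
  apply: (ae_foralln (P := fun i w => (i <= j)%N -> (j <= q)%N ->
    cvgn [normed series
      (fun n => fluctuation (fun z => (offspring j z)`_i) i n w)])) => i.
  have [ij|ji] := leqP i j; last by apply: aeW => w.
  have [jq|qj] := leqP j q; last by apply: aeW => w.
  by apply: filterS (offspring_coef_summable ij jq).
apply: filterS => w cw.
pose W := population_limit delta m w.
pose F j i n := fluctuation (fun z => (offspring j z)`_i) i n w.
pose e j n := m^-1 * \sum_(i < j.+1) F j i n.
have rec j n : power_mean j n.+1 w =
    \sum_(i < j.+1) offspring_moment j i * power_mean i n w + e j n.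
  rewrite power_meanS exprS invfM -mulrA.
  rewrite (generation_poly_sum n w (poly_growth_offspring j)) big_split /= mulrDr.
  rewrite addrC; congr (_ + _); rewrite mulr_sumr; apply: eq_bigr => i _.
  by rewrite /offspring_moment mulrCA mulrA.
have F0 j i : (i <= j)%N -> (j <= q)%N -> F j i n @[n --> \oo] --> 0.
  by move=> ij jq; apply: cvg_series_cvg_0; exact: normed_cvg (cw j i ij jq).
have e0 j : (j <= q)%N -> e j n @[n --> \oo] --> 0.
  move=> jq; rewrite -(mulr0 m^-1); apply: cvgMr.
  rewrite [X in _ --> X](_ : _ = \sum_(i < j.+1) (0 : R)); last by rewrite big1.
  apply: (@cvg_bigsum _ _ _ (fun (i : 'I_j.+1) n => F j i n) (fun=> 0)) => i.
  by apply: F0 => //; rewrite -ltnS.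
have cS0 : cvgn (power_mean 0 ^~ w).
  apply: (@cvg_increments _ _ (fun n => m^-1 * F 0%N 0%N n)).
    move=> n; rewrite rec big_ord_recl big_ord0 addr0 offspring_moment00 mul1r.
    by rewrite addrC addKr /e big_ord_recl big_ord0 addr0.
  rewrite (_ : (fun n => m^-1 * F 0%N 0%N n) = m^-1 *: (F 0%N 0%N)); last first.
    by apply/funext.
  by apply: is_cvg_seriesZ; exact: normed_cvg (cw 0%N 0%N (leqnn 0) (leq0n q)).
have cW : power_mean 0 n w @[n --> \oo] --> W.
  rewrite /W /population_limit (_ : (fun n => _ / _) = power_mean 0 ^~ w)//.
  by apply/funext => n; rewrite power_mean0E.
have cvg0 : forall j, (j <= q)%N ->
    power_mean j n w - l j * W @[n --> \oo] --> 0.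
  apply: (@triangular_cvg0 _ (fun j n => power_mean j n w - l j * W) e
    offspring_moment q).
  - move=> j n jq; rewrite rec {1}lE// mulr_suml addrAC -sumrB; congr (_ + _).
    by apply: eq_bigr => i _; ring.
  - move=> j /andP[j0 jq]; apply: offspring_contracting.
    by rewrite j0 (leq_trans jq).
  - exact: e0.
  - by rewrite l0 mul1r -(subrr W); apply: cvgB => //; exact: cvg_cst.
move=> j jq; have -> : power_mean j ^~ w =
    (fun n => power_mean j n w - l j * W + l j * W).
  by apply/funext => n; rewrite subrK.
rewrite -[X in _ --> X]add0r; apply: cvgD; first exact: cvg0.
exact: cvg_cst.
Qed.

Lemma poly_law_of_large_numbers (l : nat -> R) p : l 0%N = 1 ->
  (forall j, (j <= q)%N -> l j = \sum_(i < j.+1) offspring_moment j i * l i) ->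
  poly_growth weight q p ->
  {ae P, forall w,
    m ^- n * \sum_(k <- generation n) alive k w * (p (draw k w)).[X k w]
      @[n --> \oo]
    --> (\sum_(i < q.+1) draw_mean (fun z => (p z)`_i) * l i)
        * population_limit delta m w}.
Proof.
move=> l0 lE gp; have [_ mp [C HC]] := gp.
have : {ae P, forall w i, (i <= q)%N -> cvgn [normed series
    (fun n => fluctuation (fun z => (p z)`_i) i n w)]}.
  apply: (ae_foralln (P := fun i w => (i <= q)%N ->
    cvgn [normed series (fun n => fluctuation (fun z => (p z)`_i) i n w)])) => i.
  have [iq|qi] := leqP i q; last by apply: aeW => w.
  have := fluctuation_summable (mp i) (fun z => HC i z) iq.
  by apply: filterS.
apply: filterS2 (power_mean_cvg l0 lE) => w Sw Fw.
rewrite mulr_suml; under eq_fun do rewrite (generation_poly_sum _ _ gp).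
apply: (@cvg_bigsum _ _ _ (fun (i : 'I_q.+1) n =>
  fluctuation (fun z => (p z)`_i) i n w
  + draw_mean (fun z => (p z)`_i) * power_mean i n w)
  (fun i => draw_mean (fun z => (p z)`_i) * l i * population_limit delta m w)) => i.
have iq : (i <= q)%N by rewrite -ltnS.
rewrite -[X in _ --> X]add0r -mulrA; apply: cvgD; last exact: cvgMr (Sw i iq).
by apply: cvg_series_cvg_0; exact: normed_cvg (Fw i iq).
Qed.

(** * The class F and the kernel P *)

Definition child_value (u : bool) (x : R) : option R := if u then Some x else None.

(** Sending an unobserved child to the cemetery point amounts to multiplying by
    its mark, since a generator of the class vanishes as soon as a child on
    which it depends is there. *)
Lemma Fgen_poly kappa g : (forall n : nat, n%:R <= kappa -> (n <= q)%N) ->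
  Fgen kappa g -> exists2 p, poly_growth weight q p &
    forall x (z : fresh), g (Some x) (child_value z.2.1 (aff0 z).[x])
      (child_value z.2.2 (aff1 z).[x]) = (p z).[x].
Proof.
move=> kq [al [be [ta [/kq abq gE]]]].
have gX n : poly_growth weight n (fun=> 'X^n).
  by have := poly_growthX weight_ge1 n (poly_growth_var weight_ge1); rewrite mul1n.
have gM r s p p' : (r + s <= q)%N -> poly_growth weight r p ->
    poly_growth weight s p' -> poly_growth weight q (fun z => p z * p' z).
  move=> rs gp gp'; apply: (poly_growth_le weight_ge1 rs).
  exact: (poly_growthM weight_ge1).
have g0 n := poly_growth_child0 (poly_growth_aff0X n).
have g1 n := poly_growth_child1 (poly_growth_aff1X n).
case: gE => ->.
- exists (fun z : fresh => 'X^al * ((z.2.1%:R)%:P * aff0 z ^+ be)).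
    by apply: (@gM al be) => //; rewrite (leq_trans _ abq)// leq_addr.
  move=> x z; rewrite hornerM hornerXn hornerM hornerC horner_exp /child_value.
  by case: z.2.1; rewrite /= ?mul1r ?mul0r.
- exists (fun z : fresh => 'X^al * ((z.2.2%:R)%:P * aff1 z ^+ ta)).
    by apply: (@gM al ta) => //; rewrite (leq_trans _ abq)// addnAC leq_addr.
  move=> x z; rewrite hornerM hornerXn hornerM hornerC horner_exp /child_value.
  by case: z.2.2; rewrite /= ?mul1r ?mul0r.
- exists (fun z : fresh => 'X^al * ((z.2.1%:R)%:P * aff0 z ^+ be) *
                   ((z.2.2%:R)%:P * aff1 z ^+ ta)).
    apply: (@gM (al + be)%N ta) => //; exact: (poly_growthM weight_ge1).
  move=> x z; rewrite !hornerM hornerXn !hornerC !horner_exp /child_value.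
  by case: z.2.1; case: z.2.2; rewrite /= ?mul1r ?mul0r ?mulr0 ?mul0r.
Qed.

Lemma Fclass_poly kappa f : (forall n : nat, n%:R <= kappa -> (n <= q)%N) ->
  Fclass kappa f -> exists2 p, poly_growth weight q p &
    forall x (z : fresh), f (Some x) (child_value z.2.1 (aff0 z).[x])
      (child_value z.2.2 (aff1 z).[x]) = (p z).[x].
Proof.
move=> kq [n [coef [g [Fg fE]]]].
have /choice[p Hp] : forall i, exists p, poly_growth weight q p /\
    forall x (z : fresh), g i (Some x) (child_value z.2.1 (aff0 z).[x])
      (child_value z.2.2 (aff1 z).[x]) = (p z).[x].
  by move=> i; have [p gp pE] := Fgen_poly kq (Fg i); exists p.
exists (fun z : fresh => \sum_(i < n) coef i *: p i z).
  apply: (poly_growth_sum weight_ge1) => i.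
  by apply: (poly_growthZ weight_ge1); exact: (Hp i).1.
move=> x z; rewrite fE horner_sum; apply: eq_bigr => i _.
by rewrite hornerZ (Hp i).2.
Qed.

Lemma horner_expectation p u x : poly_growth weight q p ->
  P.-integrable setT (EFin \o (fun w => (p (noise eps eta 1 w, u)).[x])) /\
  \int[P]_w (p (noise eps eta 1 w, u)).[x] =
  \sum_(i < q.+1) \int[P]_w (p (noise eps eta 1 w, u))`_i * x ^+ i.
Proof.
move=> [sp mp [C HC]].
have hE w : (p (noise eps eta 1 w, u)).[x] =
    \sum_(i < q.+1) x ^+ i * (p (noise eps eta 1 w, u))`_i.
  rewrite (horner_coef_wide _ (sp _)).
  by apply: eq_bigr => i _; rewrite mulrC.
have iP (i : 'I_q.+1) := growth_int1 u q_le_Q (mp i) (fun z => HC i z).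
have [iS eS] := Rintegral_sum (s := index_enum 'I_q.+1)
  (h := fun (i : 'I_q.+1) w => x ^+ i * (p (noise eps eta 1 w, u))`_i)
  (fun i _ => integrableZ (x ^+ i) (iP i)).
split; first by apply: eq_integrable iS => // w _; rewrite /= hE.
under eq_Rintegral do rewrite hE.
by rewrite eS; apply: eq_bigr => i _; rewrite RintegralZl// mulrC.
Qed.

(** P f is the average of f over one draw, with the four values of the marks
    weighted by their probabilities. *)
Lemma kernelP_poly f p x : poly_growth weight q p ->
  (forall x (z : fresh), f (Some x) (child_value z.2.1 (aff0 z).[x])
      (child_value z.2.2 (aff1 z).[x]) = (p z).[x]) ->
  kernelP P a b c d p0 p1 p01 eps eta f x =
  (\sum_(i < q.+1) draw_mean (fun z => (p z)`_i) * x ^+ i)%:E.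
Proof.
move=> gp fp.
pose I u := \int[P]_w (p (noise eps eta 1 w, u)).[x].
have EI u : (\int[P]_w ((p (noise eps eta 1 w, u)).[x])%:E)%E = (I u)%:E.
  by rewrite fineK//; exact: integrable_fin_num (horner_expectation u x gp).1.
have -> : \sum_(i < q.+1) draw_mean (fun z => (p z)`_i) * x ^+ i =
    \sum_(u <- kept_values) kept_prob u * I u.
  rewrite /draw_mean; under eq_bigr do rewrite mulr_suml.
  rewrite exchange_big; apply: eq_bigr => u _ /=.
  rewrite /I (horner_expectation u x gp).2 mulr_sumr.
  by apply: eq_bigr => i _; rewrite mulrA.
have X0 w u : (aff0 (noise eps eta 1 w, u)).[x] =
    (b + eta 2%N w) * x + a + eps 2%N w.
  by rewrite /aff0 horner_affine_poly /= addrA.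
have X1 w u : (aff1 (noise eps eta 1 w, u)).[x] =
    (d + eta 3%N w) * x + c + eps 3%N w.
  by rewrite /aff1 horner_affine_poly /= addrA.
have fE u w : (p (noise eps eta 1 w, u)).[x] = f (Some x)
    (child_value u.1 ((b + eta 2%N w) * x + a + eps 2%N w))
    (child_value u.2 ((d + eta 3%N w) * x + c + eps 3%N w)).
  by rewrite -fp X0 X1.
have EI' u : (\int[P]_w (f (Some x)
    (child_value u.1 ((b + eta 2%N w) * x + a + eps 2%N w))
    (child_value u.2 ((d + eta 3%N w) * x + c + eps 3%N w)))%:E)%E = (I u)%:E.
  by rewrite -EI; apply: eq_integral => w _; rewrite fE.
have e11 := EI' (true, true); have e10 := EI' (true, false).
have e01 := EI' (false, true); rewrite /= in e11 e10 e01.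
have e00 : I (false, false) = f (Some x) None None.
  by rewrite /I; under eq_Rintegral do rewrite fE /=;
     rewrite Rintegral_probability_cst.
rewrite /kernelP unlock e11 e10 e01 -!EFinM -!EFinD; congr EFin.
rewrite /kept_values !big_cons big_nil /kept_prob /= e00; ring.
Qed.

(** The two weights are the probabilities that the mixed pair is that of the
    first, respectively of the second, child: the c_ji are those of mu. *)
Lemma offspring_momentE j i : (j <= Q)%N -> offspring_moment j i =
  (p0 + p01) / m * \int[P]_w (affine_poly (a + eps 2%N w, b + eta 2%N w) ^+ j)`_i
  + (p1 + p01) / m * \int[P]_w (affine_poly (c + eps 3%N w, d + eta 3%N w) ^+ j)`_i.
Proof.
move=> jQ.
have [_ m0 [C0 H0]] := poly_growth_aff0X j.
have [_ m1 [C1 H1]] := poly_growth_aff1X j.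
have i0 := growth_int1 (true, true) jQ (m0 i) (fun z => H0 i z).
have i1 := growth_int1 (true, true) jQ (m1 i) (fun z => H1 i z).
pose I0 := \int[P]_w (affine_poly (a + eps 2%N w, b + eta 2%N w) ^+ j)`_i.
pose I1 := \int[P]_w (affine_poly (c + eps 3%N w, d + eta 3%N w) ^+ j)`_i.
have uE u : \int[P]_w (offspring j (noise eps eta 1 w, u))`_i =
    u.1%:R * I0 + u.2%:R * I1.
  rewrite -RintegralZl// -[in X in _ + X]RintegralZl// -RintegralD//; last 2 first.
  - exact: integrableZ.
  - exact: integrableZ.
  by apply: eq_Rintegral => w _; rewrite /offspring coefD !coefCM.
rewrite /offspring_moment /draw_mean /kept_values !big_cons big_nil !uE /kept_prob /=.
rewrite -/I0 -/I1; field.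
exact: m_neq0.
Qed.

End tree.

(** * Moment bounds *)

Section moments.
Context {d} {T : measurableType d} {R : realType}.
Variable P : probability T R.

Definition has_moment n (Z : T -> R) : Prop :=
  measurable_fun setT Z /\ P.-integrable setT (EFin \o (fun w => `|Z w| ^+ n)).

Lemma has_moment_cst n (c : R) : has_moment n (fun=> c).
Proof.
split; first exact: measurable_cst.
exact: finite_measure_integrable_cst.
Qed.

Lemma has_moment_norm n Z : has_moment n Z -> has_moment n (fun w => `|Z w|).
Proof.
move=> [mZ iZ]; split; first exact: (measurableT_comp (@normr_measurable R setT)).
by apply: eq_integrable iZ => // w _; rewrite /= normr_id.
Qed.

Lemma has_momentD n Y Z : has_moment n Y -> has_moment n Z ->
  has_moment n (fun w => Y w + Z w).
Proof.
move=> [mY iY] [mZ iZ]; have mYZ : measurable_fun setT (fun w => Y w + Z w).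
  exact: measurable_funD.
split => //; apply: (@bounded_integrable _ _ _ P _
  (fun w => 2 ^+ n * (`|Y w| ^+ n + `|Z w| ^+ n))).
- by apply: measurable_funX; exact: (measurableT_comp (@normr_measurable R setT)).
- apply: integrableZ; have := integrableD measurableT iY iZ.
  by apply: eq_integrable.
- move=> w; rewrite ger0_norm ?exprn_ge0//.
  wlog le : Y Z {mY iY mZ iZ mYZ} / `|Y w| <= `|Z w|.
    move=> H; have [le|/ltW le] := leP `|Y w| `|Z w|; first exact: H.
    by rewrite [Y w + _]addrC [X in _ * X]addrC; exact: H.
  apply: (@le_trans _ _ ((2 * `|Z w|) ^+ n)).
    rewrite lerXn2r ?nnegrE ?mulr_ge0// (le_trans (ler_normD _ _))//.
    by rewrite mulr2n mulrDl mul1r lerD2r.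
  by rewrite exprMn ler_wpM2l ?exprn_ge0// lerDr exprn_ge0.
Qed.

Lemma finite_moments_has_moment (s : R) n (Z : {mfun T >-> R}) :
  finite_moments P s Z -> n%:R <= s -> has_moment n Z.
Proof.
move=> fZ ns; split => //; apply/integrableP; split.
  apply/measurable_EFinP; apply: measurable_funX.
  exact: (measurableT_comp (@normr_measurable R setT)).
have := fZ n%:R; rewrite ler0n ns unlock => /(_ isT).
apply: le_lt_trans; rewrite le_eqVlt; apply/orP; left; apply/eqP.
apply: eq_integral => w _ /=.
by rewrite ger0_norm ?exprn_ge0// powR_mulrn.
Qed.

Lemma has_moment_int n Z : has_moment n Z ->
  P.-integrable setT (EFin \o (fun w => Z w ^+ n)).
Proof.
move=> [mZ iZ]; apply: bounded_integrable iZ _; first exact: measurable_funX.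
by move=> w; rewrite normrX.
Qed.

(** Young's inequality for t^j * 1 with the exponents s/j and s/(s-j). *)
Lemma young_exponent (t s : R) j : 0 <= t -> (0 < j)%N -> j%:R < s ->
  t ^+ j <= j%:R / s * t `^ s + (1 - j%:R / s).
Proof.
move=> t0 j0 js; have j0' : 0 < j%:R :> R by rewrite ltr0n.
have s0 : 0 < s := lt_trans j0' js.
have := @conjugate_powR R (t ^+ j) 1 (s / j%:R) (s / (s - j%:R)).
rewrite exprn_ge0// ler01 !divr_gt0 ?subr_gt0// => /(_ isT isT isT isT).
rewrite powR1 mul1r mulr1 !invf_div -powR_mulrn// -powRrM.
rewrite [j%:R * _]mulrC divfK ?gt_eqF// => H.
rewrite (le_trans (H _))//.
  by rewrite -mulrDl addrC subrK divff// gt_eqF.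
by rewrite mulrC lerD2l mulrBl divff ?gt_eqF.
Qed.

(** Passing from a moment of order s to one of order j < s.  The weight al is
    kept inside because the moment of order s may be infinite when al = 0. *)
Lemma young_moment (Z : T -> R) (s al : R) j : measurable_fun setT Z ->
  (0 < j)%N -> j%:R < s -> 0 <= al -> has_moment j Z ->
  (al%:E * 'E_P[fun w => (`|Z w| `^ s)%R] < +oo)%E ->
  al * \int[P]_w (`|Z w| ^+ j) <=
    j%:R / s * fine (al%:E * 'E_P[fun w => (`|Z w| `^ s)%R])%E + (1 - j%:R / s) * al.
Proof.
move=> mZ j0 js al0 [_ iZ] fin.
have j0' : 0 < j%:R :> R by rewrite ltr0n.
have s0 : 0 < s := lt_trans j0' js.
have E0 : (0 <= 'E_P[fun w => (`|Z w| `^ s)%R])%E.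
  by apply: expectation_ge0 => w; exact: powR_ge0.
move: al0; rewrite le_eqVlt => /orP[/eqP <-|al0].
  by rewrite mul0e mul0r !mulr0 addr0.
have mp : measurable_fun setT (fun w => `|Z w| `^ s).
  apply: (measurableT_comp (measurable_powR _)).
  exact: (measurableT_comp (@normr_measurable R setT)).
have Efin : ('E_P[fun w => (`|Z w| `^ s)%R])%E \is a fin_num.
  rewrite ge0_fin_numE// ltey; apply/eqP => Eoo; move: fin.
  by rewrite Eoo gt0_muley// lte_fin.
have ip : P.-integrable setT (EFin \o (fun w => `|Z w| `^ s)).
  apply/integrableP; split; first exact/measurable_EFinP.
  move: Efin; rewrite ge0_fin_numE// unlock; apply: le_lt_trans.
  rewrite le_eqVlt; apply/orP; left; apply/eqP.
  by apply: eq_integral => w _; rewrite /= ger0_norm// powR_ge0.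
rewrite fineM//= mulrCA [X in _ + X]mulrC -mulrDr; apply: ler_wpM2l; first exact: ltW.
rewrite unlock -/(Rintegral P setT (fun w => `|Z w| `^ s)).
have ic : P.-integrable setT (EFin \o (fun=> 1 - j%:R / s)).
  exact: finite_measure_integrable_cst.
rewrite -RintegralZl// -[1 - _](Rintegral_probability_cst P) -RintegralD//; last first.
  exact: integrableZ.
apply: le_Rintegral => //.
  have := integrableD measurableT (integrableZ (j%:R / s) ip) ic.
  by apply: eq_integrable.
by move=> w _; exact: young_exponent.
Qed.

End moments.

(** * The law of the mixed pair *)

Section bernoulli_mixture.
Context {d} {T : measurableType d} {R : realType}.
Variable P : probability T R.
Variable r : R.
Hypothesis r01 : 0 <= r <= 1.

Let PP : probability (bool * T)%type R := (bernoulli_prob r \x P)%E.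

Let PPX (A : set bool) (B : set T) : measurable B ->
  PP (A `*` B) = (bernoulli_prob r A * P B)%E.
Proof. by move=> mB; exact: product_measure1E. Qed.

Let snd_law E : measurable E -> PP (snd @^-1` E) = P (id @^-1` E).
Proof.
move=> mE; rewrite (_ : snd @^-1` E = setT `*` E); last first.
  by apply/seteqP; split=> -[z w] //= [].
by rewrite PPX// probability_setT mul1e.
Qed.

(** The two coordinates of a product space are independent. *)
Lemma bernoulli_choice_integral (b : bool) (G : T -> R) :
  P.-integrable setT (EFin \o G) ->
  PP.-integrable setT (EFin \o (fun zw => (zw.1 == b)%:R * G zw.2)) /\
  \int[PP]_zw ((zw.1 == b)%:R * G zw.2) =
    (if b then r else 1 - r) * \int[P]_w G w.
Proof.
move=> iG; have mG : measurable_fun setT G.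
  by have /measurable_int/measurable_EFinP := iG.
have [i2 e2] := same_law_integral (P1 := PP) (P2 := P) measurable_snd
  (@measurable_id _ _ _) snd_law mG iG.
pose chi (zw : bool * T) : R := (zw.1 == b)%:R.
have mchi : measurable_fun setT chi.
  have mb : measurable_fun setT (fun z : bool => (z == b)%:R : R) by [].
  exact: (measurableT_comp mb measurable_fst).
have chiE : chi = \1_([set b] `*` setT).
  apply/funext => -[z w]; rewrite indicE /chi /=; congr (_%:R); congr nat_of_bool.
  by apply/eqP/idP; rewrite inE; [move=> ->|case].
have mS : measurable ([set b] `*` setT : set (bool * T)) by apply: measurableX.
have i1 : PP.-integrable setT (EFin \o chi).
  by rewrite chiE; exact: integrable_indic.
have e1 : \int[PP]_zw chi zw = if b then r else 1 - r.
  rewrite chiE /Rintegral integral_indic// setIT.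
  rewrite [X in fine X](_ : _ = bernoulli_prob r [set b] * P setT)%E; last exact: PPX.
  rewrite probability_setT mule1.
  have inb x : (x \in [set b]) = (x == b) by apply/idP/eqP; rewrite inE.
  rewrite bernoulli_probE// !diracE !inb.
  by case: (b); rewrite /= ?mulr1 ?mulr0 ?addr0 ?add0r.
rewrite -e1 -e2; apply: preimage_independent_expectationM => //.
  exact: (measurableT_comp mG measurable_snd).
move=> A B mA mB.
have mGB : measurable (G @^-1` B) by rewrite -[_ @^-1` _]setTI; exact: mG.
pose A' := (fun z : bool => (z == b)%:R : R) @^-1` A.
rewrite (_ : chi @^-1` A = A' `*` setT); last first.
  by apply/seteqP; split=> -[z w] //= [].
rewrite (_ : (fun x => G x.2) @^-1` B = setT `*` (G @^-1` B)); last first.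
  by apply/seteqP; split=> -[z w] //= [].
rewrite -setXI setIT setTI !PPX// !probability_setT.
by rewrite mul1e mule1.
Qed.

Lemma bernoulli_mixture_integral (G0 G1 : T -> R) :
  P.-integrable setT (EFin \o G0) -> P.-integrable setT (EFin \o G1) ->
  PP.-integrable setT (EFin \o (fun zw => if zw.1 then G1 zw.2 else G0 zw.2)) /\
  \int[PP]_zw (if zw.1 then G1 zw.2 else G0 zw.2) =
    (1 - r) * \int[P]_w G0 w + r * \int[P]_w G1 w.
Proof.
move=> i0 i1.
have [j0 e0] := bernoulli_choice_integral false i0.
have [j1 e1] := bernoulli_choice_integral true i1.
have E zw : (if zw.1 then G1 zw.2 else G0 zw.2) =
    (zw.1 == false)%:R * G0 zw.2 + (zw.1 == true)%:R * G1 zw.2.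
  by case: zw => -[] w /=; rewrite ?mul0r ?mul1r ?add0r ?addr0.
split.
  have := integrableD measurableT j0 j1.
  by apply: eq_integrable => // zw _; rewrite /= E.
by under eq_Rintegral do rewrite E; rewrite RintegralD// e0 e1.
Qed.

End bernoulli_mixture.

Lemma mixed_pair_integral {d d'} {T : measurableType d} {T' : measurableType d'}
    {R : realType} (P : probability T R) (P' : probability T' R) (r a b c e : R)
    (eps eta : nat -> {mfun T >-> R}) (A B : {mfun T' >-> R})
    (g : R * R -> R) :
  0 <= r <= 1 ->
  (forall E : set (R * R), measurable E ->
     P' ((fun w => (A w, B w)) @^-1` E) =
     (bernoulli_prob r \x P)%E (mixed_pair a b c e eps eta @^-1` E)) ->
  measurable_fun setT g ->
  P.-integrable setT (EFin \o (fun w => g (a + eps 2%N w, b + eta 2%N w))) ->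
  P.-integrable setT (EFin \o (fun w => g (c + eps 3%N w, e + eta 3%N w))) ->
  P'.-integrable setT (EFin \o (fun w => g (A w, B w))) /\
  \int[P']_w g (A w, B w) =
    (1 - r) * \int[P]_w g (a + eps 2%N w, b + eta 2%N w) +
    r * \int[P]_w g (c + eps 3%N w, e + eta 3%N w).
Proof.
move=> r01 law mg i0 i1.
have mAB : measurable_fun setT (fun w => (A w, B w)) by exact/measurable_fun_pair.
have mM : measurable_fun setT (mixed_pair a b c e eps eta).
  rewrite (_ : mixed_pair a b c e eps eta = fun zw => if zw.1
    then (c + eps 3%N zw.2, e + eta 3%N zw.2)
    else (a + eps 2%N zw.2, b + eta 2%N zw.2)); last first.
    by apply/funext => -[[] w].
  apply: measurable_fun_ifT; first exact: measurable_fst.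
    by apply/measurable_fun_pair; apply: measurable_funD;
      [exact: measurable_cst|exact: measurableT_comp|
       exact: measurable_cst|exact: measurableT_comp].
  by apply/measurable_fun_pair; apply: measurable_funD;
      [exact: measurable_cst|exact: measurableT_comp|
       exact: measurable_cst|exact: measurableT_comp].
have [iM <-] := bernoulli_mixture_integral r01 i0 i1.
have gE zw : g (mixed_pair a b c e eps eta zw) = if zw.1
    then g (c + eps 3%N zw.2, e + eta 3%N zw.2)
    else g (a + eps 2%N zw.2, b + eta 2%N zw.2).
  by case: zw => -[] w.
have iM' : (bernoulli_prob r \x P)%E.-integrable setT
    (EFin \o (g \o mixed_pair a b c e eps eta)).
  by apply: eq_integrable iM => // zw _; rewrite /= gE.
have [iA eA] := same_law_integral mAB mM law mg iM'.
split => //.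
by rewrite eA; apply: eq_Rintegral => zw _; rewrite gE.
Qed.

(** * The law of large numbers *)

Unset Implicit Arguments.
Set Strict Implicit.

Theorem theorem4p10 (R : realType)
    (disp : measure_display) (T : measurableType disp) (P : probability T R)
    (a b c d : R) (X eps eta : nat -> {RV P >-> R})
    (* R-BAR process *)
    (XE : forall k w, (0 < k)%N ->
       X (2 * k)%N w
         = (b + eta (2 * k)%N w) * X k w + a + eps (2 * k)%N w /\
       X (2 * k + 1)%N w
         = (d + eta (2 * k + 1)%N w) * X k w + c + eps (2 * k + 1)%N w)
    (* observation process *)
    (p0 p1 p01 : R) (xi0 xi1 : nat -> {RV P >-> bool})
    (delta : nat -> T -> bool)
    (delta1 : forall w, delta 1%N w = true)
    (deltaE : forall k w, (0 < k)%N ->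
       delta (2 * k)%N w = delta k w && xi0 k w /\
       delta (2 * k + 1)%N w = delta k w && xi1 k w)
    (xi_iid : iid P (fun k w => (xi0 k w, xi1 k w)))
    (xi_law : [/\ P [set w | xi0 1%N w = true /\ xi1 1%N w = false] = p0%:E,
                  P [set w | xi0 1%N w = false /\ xi1 1%N w = true] = p1%:E,
                  P [set w | xi0 1%N w = true /\ xi1 1%N w = true] = p01%:E &
                  P [set w | xi0 1%N w = false /\ xi1 1%N w = false]
                    = (1 - p0 - p1 - p01)%:E])
    (* (H.1) *)
    (H1 : iid P (noise eps eta) /\
          independent P (events_seq (noise eps eta)) (events (X 1%N)))
    (* (H.2) *)
    (gamma sigma_eps sigma_eta rho_eps rho_eta : R) (rho : 'I_2 -> 'I_2 -> R)
    (gamma_ge1 : 1 <= gamma)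
    (H2_moments : [/\ finite_moments P (4 * gamma) (eps 2%N),
                      finite_moments P (4 * gamma) (eta 2%N),
                      finite_moments P (4 * gamma) (eps 3%N),
                      finite_moments P (4 * gamma) (eta 3%N) &
                      finite_moments P (4 * gamma) (X 1%N)])
    (H2_eps : [/\ 'E_P[eps 2%N] = 0%:E, 'E_P[eps 3%N] = 0%:E,
                  'E_P[fun w => (eps 2%N w ^+ 2)%R] = (sigma_eps ^+ 2)%R%:E,
                  'E_P[fun w => (eps 3%N w ^+ 2)%R] = (sigma_eps ^+ 2)%R%:E &
                  'E_P[fun w => (eps 2%N w * eps 3%N w)%R] = rho_eps%:E]%E)
    (sigma_eps_gt0 : 0 < sigma_eps ^+ 2)
    (H2_eta : [/\ 'E_P[eta 2%N] = 0%:E, 'E_P[eta 3%N] = 0%:E,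
                  'E_P[fun w => (eta 2%N w ^+ 2)%R] = (sigma_eta ^+ 2)%R%:E,
                  'E_P[fun w => (eta 3%N w ^+ 2)%R] = (sigma_eta ^+ 2)%R%:E &
                  'E_P[fun w => (eta 2%N w * eta 3%N w)%R] = rho_eta%:E]%E)
    (sigma_eta_gt0 : 0 < sigma_eta ^+ 2)
    (H2_cross : forall i j : 'I_2,
       ('E_P[fun w => (eps (2 + i)%N w * eta (2 + j)%N w)%R] = (rho i j)%:E)%E)
    (* (H.3) *)
    (H3 : independent P (events_seq (fun k w => (xi0 k w, xi1 k w)))
                        (events_seq (noise eps eta) `|` events (X 1%N)))
    (* (H.4) *)
    (m : R) (mE : m = 2 * p01 + p0 + p1)
    (H4 : 1 < m)
    (* (H.5) *)
    (kappa : R) (kappa_bounds : 1 <= kappa <= gamma)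
    (H5 : (((p0 + p01) / m)%R%:E
             * 'E_P[fun w => (`|b + eta 2%N w| `^ (4 * kappa))%R]
           + ((p1 + p01) / m)%R%:E
             * 'E_P[fun w => (`|d + eta 3%N w| `^ (4 * kappa))%R] < 1)%E)
    (* the i.i.d. sequence defining mu, on an arbitrary probability space *)
    (disp' : measure_display) (T' : measurableType disp')
    (P' : probability T' R) (A B : nat -> {RV P' >-> R})
    (AB_iid : iid P' (fun n w => (A n w, B n w)))
    (AB_law : forall E : set (R * R), measurable E ->
       P' ((fun w => (A 1%N w, B 1%N w)) @^-1` E)
         = (bernoulli_prob ((p01 + p1) / m) \x P)%E
             (mixed_pair a b c d eps eta @^-1` E)) :
  let mu := distribution P' (perpetuity A B) in
  forall f : option R -> option R -> option R -> R, Fclass kappa f ->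
  {ae P, forall w,
    ((m ^- n * \sum_(k <- observed delta n w)
        f (killed X delta k w) (killed X delta (2 * k)%N w)
          (killed X delta (2 * k + 1)%N w))%:E @[n --> \oo]
     --> ((\int[mu]_x kernelP P a b c d p0 p1 p01 eps eta f x)
          * (population_limit delta m w)%:E)%E)%classic}.
Proof.
move=> mu f Ff.
have [k1 kg] := andP kappa_bounds.
have k0 : 0 <= kappa := le_trans ler01 k1.
pose q := Num.truncn kappa.
(* Degrees being integers, q, the integer part of kappa, replaces kappa. *)
have kq (n : nat) : n%:R <= kappa -> (n <= q)%N by rewrite truncn_ge_nat.
have qk : q%:R <= kappa by rewrite truncn_le.
have q_gt0 : (0 < q)%N by exact: kq.
have nQ (n : nat) : (n <= q * 2)%N -> n%:R <= 2 * kappa.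
  move=> nq; rewrite (@le_trans _ _ (q * 2)%:R) ?ler_nat// natrM mulrC.
  by rewrite ler_pM2l.
have nQg (n : nat) : (n <= q * 2)%N -> n%:R <= 4 * gamma.
  by move=> /nQ; lra.
have nQk (n : nat) : (n <= q * 2)%N -> n%:R < 4 * kappa.
  by move=> /nQ; lra.
have [l10 l01 l11 l00] := xi_law.
have p0_ge0 : 0 <= p0 by rewrite -lee_fin -l10.
have p1_ge0 : 0 <= p1 by rewrite -lee_fin -l01.
have p01_ge0 : 0 <= p01 by rewrite -lee_fin -l11.
have m_gt0 : 0 < m := lt_trans ltr01 H4.
pose al := (p0 + p01) / m; pose be := (p1 + p01) / m.
have al_ge0 : 0 <= al by rewrite divr_ge0 ?addr_ge0// ltW.
have be_ge0 : 0 <= be by rewrite divr_ge0 ?addr_ge0// ltW.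
have albe : al + be = 1.
  rewrite /al /be -mulrDl [X in X / _](_ : _ = m) ?divff ?gt_eqF//.
  by rewrite mE; ring.
have beE : (p01 + p1) / m = be by rewrite addrC.
have be01 : 0 <= be <= 1 by lra.
have [M2 N2 M3 N3 MX] := H2_moments.
have mom (n : nat) (c0 : R) (Z : {RV P >-> R}) : finite_moments P (4 * gamma) Z ->
    (n <= q * 2)%N -> has_moment P n (fun w => c0 + Z w).
  move=> fZ nq; apply: has_momentD; first exact: has_moment_cst.
  by apply: finite_moments_has_moment fZ _; exact: nQg.
(* With t = j / (4 kappa), Young's inequality bounds the left-hand side by
   t s + (1 - t), where s < 1 is the quantity of (H.5). *)
have contr (j : nat) : (0 < j <= q * 2)%N ->
    al * (\int[P]_w (`|b + eta 2%N w| ^+ j)) +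
    be * (\int[P]_w (`|d + eta 3%N w| ^+ j)) < 1.
  move=> /andP[j0 jQ].
  set E1 := ('E_P[fun w => (`|b + eta 2%N w| `^ (4 * kappa))%R])%E in H5.
  set E2 := ('E_P[fun w => (`|d + eta 3%N w| `^ (4 * kappa))%R])%E in H5.
  have E1_ge0 : (0 <= al%:E * E1)%E.
    by rewrite mule_ge0// expectation_ge0// => w; exact: powR_ge0.
  have E2_ge0 : (0 <= be%:E * E2)%E.
    by rewrite mule_ge0// expectation_ge0// => w; exact: powR_ge0.
  have H5' : (al%:E * E1 + be%:E * E2 < 1)%E by [].
  have F1 : (al%:E * E1 < +oo)%E.
    by apply: le_lt_trans (lt_trans H5' (ltry 1)); rewrite leeDl.
  have F2 : (be%:E * E2 < +oo)%E.
    by apply: le_lt_trans (lt_trans H5' (ltry 1)); rewrite leeDr.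
  have [mZ1 mZ2] := (mom j b (eta 2%N) N2 jQ, mom j d (eta 3%N) N3 jQ).
  have y1 := young_moment mZ1.1 j0 (nQk _ jQ) al_ge0 mZ1 F1.
  have y2 := young_moment mZ2.1 j0 (nQk _ jQ) be_ge0 mZ2 F2.
  have F12 : fine (al%:E * E1)%E + fine (be%:E * E2)%E < 1.
    by rewrite -lte_fin EFinD !fineK// ge0_fin_numE.
  apply: (le_lt_trans (lerD y1 y2)); rewrite -/E1 -/E2.
  have k4 : 0 < 4 * kappa by lra.
  have t0 : 0 < j%:R / (4 * kappa) by rewrite divr_gt0// ltr0n.
  set t := j%:R / _ in t0 *; set A1 := fine _ in F12 *; set A2 := fine _ in F12 *.
  nra.
have wmom : has_moment P (q * 2) (fun w => weight a b c d (draw eps eta xi0 xi1 1 w)).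
  rewrite /weight /draw /noise /=.
  do 4 (apply: has_momentD; last by apply: has_moment_norm; exact: mom).
  exact: has_moment_cst.
have weight_int := has_moment_int wmom.
have X1_int (i : nat) : (i <= q * 2)%N ->
    P.-integrable setT (EFin \o (fun w => X 1%N w ^+ i)).
  move=> iQ; apply: has_moment_int; apply: finite_moments_has_moment MX _.
  exact: nQg.
have abs_le (j : nat) (c0 : R) (Z : {RV P >-> R}) : finite_moments P (4 * gamma) Z ->
    (j <= q * 2)%N ->
    `|\int[P]_w ((c0 + Z w) ^+ j)| <= \int[P]_w (`|c0 + Z w| ^+ j).
  move=> fZ jQ; have hZ := mom j c0 Z fZ jQ.
  rewrite (le_trans (le_normr_Rintegral _ (has_moment_int hZ)))//.
  by under eq_Rintegral do rewrite normrX.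
have off_contr (j : nat) : (0 < j <= q * 2)%N ->
    `|offspring_moment P a b c d eps eta p0 p1 p01 m j j| < 1.
  move=> jQ; have /andP[j0 jQ'] := jQ.
  rewrite (offspring_momentE _ _ _ weight_int)// -/al -/be.
  under eq_Rintegral do rewrite coef_linear_exp /=.
  under [X in _ + _ * X]eq_Rintegral do rewrite coef_linear_exp /=.
  apply: le_lt_trans (contr j jQ); rewrite (le_trans (ler_normD _ _))//.
  by rewrite (normrM al) (normrM be) !(ger0_norm al_ge0) !(ger0_norm be_ge0) lerD//
     ler_wpM2l// abs_le.
have AB_law' : forall E : set (R * R), measurable E ->
    P' ((fun w => (A 1%N w, B 1%N w)) @^-1` E) =
    (bernoulli_prob be \x P)%E (mixed_pair a b c d eps eta @^-1` E).
  by rewrite -beE.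
have pair_mom (x y : R) (Y Z : {RV P >-> R}) : finite_moments P (4 * gamma) Y ->
    finite_moments P (4 * gamma) Z ->
    P.-integrable setT (EFin \o (fun w => pair_weight (x + Y w, y + Z w) ^+ q)).
  move=> fY fZ; have qq : (q <= q * 2)%N by rewrite leq_pmulr.
  apply: has_moment_int; apply: has_momentD.
    apply: has_momentD; first exact: has_moment_cst.
    by apply: has_moment_norm; exact: mom.
  by apply: has_moment_norm; exact: mom.
have pair_coef (j i : nat) (x y : R) (Y Z : {RV P >-> R}) : (j <= q)%N ->
    finite_moments P (4 * gamma) Y -> finite_moments P (4 * gamma) Z ->
    P.-integrable setT
      (EFin \o (fun w => (affine_poly (x + Y w, y + Z w) ^+ j)`_i)).
  move=> jq fY fZ; have [_ mp [C HC]] := @poly_growth_affine R j.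
  have mYZ : measurable_fun setT (fun w => (x + Y w, y + Z w)).
    by apply/measurable_fun_pair; exact: measurable_funD.
  have [mp' _] := (mp i, I).
  apply: (@bounded_integrable _ _ _ P _
    (fun w => C * pair_weight (x + Y w, y + Z w) ^+ q)).
  - exact: (measurableT_comp mp' mYZ).
  - by apply: integrableZ; exact: pair_mom.
  - move=> w; apply: (le_trans (HC i _)); apply: ler_wpM2l.
      have := le_trans (normr_ge0 _) (HC 0%N (x + Y w, y + Z w)).
      by rewrite pmulr_lge0// exprn_gt0// (lt_le_trans ltr01)// pair_weight_ge1.
    by rewrite ler_weXn2l// pair_weight_ge1.
have mpw : measurable_fun setT (fun z : R * R => pair_weight z ^+ q).
  apply: measurable_funX; apply: measurable_funD.
    apply: measurable_funD; first exact: measurable_cst.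
    exact: (measurableT_comp (@normr_measurable R setT) measurable_fst).
  exact: (measurableT_comp (@normr_measurable R setT) measurable_snd).
have [intK _] := mixed_pair_integral be01 AB_law' mpw
  (pair_mom a b _ _ M2 N2) (pair_mom c d _ _ M3 N3).
have be1 : 1 - be = al by rewrite -albe addrK.
have per_contr (j : nat) : (0 < j <= q)%N -> \int[P']_w (`|B 1%N w| ^+ j) < 1.
  move=> /andP[j0 jq]; have jQ : (j <= q * 2)%N by rewrite (leq_trans jq)// leq_pmulr.
  have mg : measurable_fun setT (fun z : R * R => `|z.2| ^+ j).
    apply: measurable_funX.
    exact: (measurableT_comp (@normr_measurable R setT) measurable_snd).
  have [_ ->] := mixed_pair_integral be01 AB_law' mg
    (mom j b _ N2 jQ).2 (mom j d _ N3 jQ).2.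
  by rewrite be1; apply: contr; rewrite j0.
have momE (j i : nat) : (j <= q)%N -> affine_moment P' A B j i =
    offspring_moment P a b c d eps eta p0 p1 p01 m j i.
  move=> jq; have jQ : (j <= q * 2)%N by rewrite (leq_trans jq)// leq_pmulr.
  have [_ mp _] := @poly_growth_affine R j.
  have [_] := mixed_pair_integral be01 AB_law' (mp i)
    (pair_coef j i a b _ _ jq M2 N2) (pair_coef j i c d _ _ jq M3 N3).
  rewrite /affine_moment => ->.
  by rewrite (offspring_momentE _ _ _ weight_int)// be1.
pose l (j : nat) := \int[P']_w (perpetuity A B w ^+ j).
have l0 : l 0%N = 1.
  by rewrite /l; under eq_Rintegral do rewrite expr0;
     rewrite Rintegral_probability_cst.
have lE (j : nat) : (j <= q)%N -> l j = \sum_(i < j.+1)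
    offspring_moment P a b c d eps eta p0 p1 p01 m j i * l i.
  move=> jq; rewrite /l (perpetuity_moment_fixpoint AB_iid q_gt0 intK per_contr jq).
  by apply: eq_bigr => i _; rewrite momE.
have l_int (j : nat) : (j <= q)%N ->
    P'.-integrable setT (EFin \o (fun w => perpetuity A B w ^+ j)).
  by move=> jq; have [] := perpetuity_moment AB_iid q_gt0 intK per_contr jq.
have [p gp fp] := Fclass_poly a b c d kq Ff.
pose h (i : nat) := draw_mean P eps eta p0 p1 p01 (fun z => (p z)`_i).
have kE x : kernelP P a b c d p0 p1 p01 eps eta f x =
    (\sum_(i < q.+1) h i * x ^+ i)%:E.
  exact: (kernelP_poly _ _ _ weight_int (leqnn _) x gp fp).
have muE : (\int[mu]_x kernelP P a b c d p0 p1 p01 eps eta f x)%E =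
    (\sum_(i < q.+1) h i * l i)%:E.
  under eq_integral do rewrite kE.
  have hi (i : 'I_q.+1) := integrableZ (h i) (l_int i (ltn_ord i)).
  have [iS eS] := Rintegral_sum (s := index_enum 'I_q.+1) (fun i _ => hi i).
  rewrite integral_distribution//; last first.
    apply/measurable_EFinP; apply: measurable_sum => i.
    by apply: measurable_funM => //; exact: measurable_funX.
  rewrite -[LHS]fineK; last exact: integrable_fin_num iS.
  congr EFin; rewrite -[LHS]/(\int[P']_w (\sum_(i < q.+1) h i * perpetuity A B w ^+ i)).
  by rewrite eS; apply: eq_bigr => i _; rewrite RintegralZl//;
     exact: (l_int i (ltn_ord i)).
have LLN := poly_law_of_large_numbers XE delta1 deltaE xi_iid xi_law H1.1 H1.2 H3
  weight_int X1_int mE H4 off_contr (leqnn _) l0 lE gp.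
apply: filterS LLN => w cw.
rewrite muE -EFinM; apply: cvg_EFin; first exact: nearW.
rewrite (_ : fine \o _ = fun n => m ^- n * \sum_(k <- generation n)
  alive delta k w * (p (draw eps eta xi0 xi1 k w)).[X k w])//.
apply/funext => n /=; congr (_ * _); rewrite /observed /generation.
rewrite big_filter big_mkcond /=.
apply: eq_big_seq => k kn0; have kn := generation_gt0 kn0.
rewrite /alive /killed; case: (boolP (delta k w)) => [dk|_]; last by rewrite mul0r.
rewrite mul1r -fp /child_value; have [-> ->] := deltaE k w kn; rewrite dk /=.
have [-> ->] := X_double XE xi0 xi1 w kn.
by [].
Qed.
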